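(* Let $(X_t)_{t\in[0,\infty)}$ be a real-valued Gaussian process on a probability space with measure $\mathbb{P}$ such that: (i) $X_0=0$ $\mathbb{P}$-almost surely; (ii) $\mathbb{E}(X_t)=0$ for all $t\in[0,\infty)$; (iii) for every $\tau\in[0,\infty)$, the covariance $\mathrm{Cov}(X_{t+\tau+1}-X_{t+\tau},\,X_{t+1}-X_t)$ does not depend on $t\in[0,\infty)$; (iv) $0<\mathrm{Var}(X_t)<\infty$ for all $t\in(0,\infty)$. Let $c(\tau)=\mathrm{Cov}(X_{\tau+1}-X_\tau,X_1)/\mathrm{Var}(X_1)$ for $\tau\in[0,\infty)$, and assume that for some constant $H$ with $0.5\le H<1$ the limit $\lim_{\tau\to\infty} c(\tau)/\tau^{2H-2}$ exists (in $\mathbb{R}$) and is different from $0$. Then the Hurst exponent of $(X_t)$, i.e. the number $1+\frac12\lim_{\tau\to\infty}\frac{\log|c(\tau)|}{\log\tau}$, exists and equals $H$, and $$\liminf_{\tau\to\infty} H(\tau)\;\le\; H\;\le\;\limsup_{\tau\to\infty} H(\tau),$$ where $H(\tau)$ is the Hurst exponent of delay $\tau$. Thus, if the limit $\lim_{\tau\to\infty}H(\tau)$ exists, then it necessarily equals $H$.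
   Context: A process is Gaussian if all its finite-dimensional distributions are (possibly degenerate) multivariate normal. All limits $\tau\to\infty$ are over real $\tau$. For a stochastic process $(X_t)_{t\in[0,\infty)}$ and $\tau\in(0,\infty)$, the change probability of delay $\tau$ is $$p(\tau)=\mathbb{P}(X_0<X_\tau,\ X_\tau\ge X_{2\tau})+\mathbb{P}(X_0\ge X_\tau,\ X_\tau<X_{2\tau}).$$ The Hurst exponent of delay $\tau$ is $H(\tau)=h(p(\tau))$, where $h(x)=1+\log_2\bigl(\sin(\pi(1-x)/2)\bigr)$ for $x\in(0,1)$, extended by the same formula to $h(0)=1$ and $h(1)=-\infty$. *)

(* Defs.v *)
From HB Require Import structures.
From mathcomp Require Import all_boot all_order all_algebra.
From mathcomp Require Import all_classical all_reals all_analysis.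
Set Implicit Arguments.
Unset Strict Implicit.
Unset Printing Implicit Defensive.
Import Order.TTheory GRing.Theory Num.Theory.
Import numFieldNormedType.Exports.
Local Open Scope classical_set_scope.
Local Open Scope ring_scope.

Definition tuple_cons (R : realType) (k : nat)
    (p : measurableTypeR R * k.-tuple (measurableTypeR R)) :
  k.+1.-tuple (measurableTypeR R) := [the k.+1.-tuple _ of p.1 :: p.2].

Lemma measurable_tuple_cons (R : realType) (k : nat) :
  measurable_fun [set: measurableTypeR R * k.-tuple (measurableTypeR R)]
    (@tuple_cons R k).
Proof. by apply: measurable_cons. Qed.

HB.instance Definition _ (R : realType) (k : nat) :=
  isMeasurableFun.Build _ _ _ _ (@tuple_cons R k) (@measurable_tuple_cons R k).

(* The law on R^k of k independent standard normal variables, obtained as an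
   iterated product measure. *)
Fixpoint std_gaussian (R : realType) (k : nat) :
    probability (k.-tuple (measurableTypeR R)) R :=
  match k with
  | 0 => \d_ [tuple]
  | k'.+1 =>
    distribution (normal_prob 0%R 1%R \x std_gaussian R k')%E (@tuple_cons R k')
  end.

Definition affine_tuple (R : realType) (n k : nat) (m : 'cV[R]_n)
    (A : 'M[R]_(n, k)) (z : k.-tuple (measurableTypeR R)) :
  n.-tuple (measurableTypeR R) :=
  [tuple m i 0 + \sum_(j < k) A i j * tnth z j | i < n].

(* mu is the law of m + A Z with Z a standard normal vector; the matrix A is
   arbitrary, so that degenerate laws (including point masses) are covered. *)
Definition multivariate_normal (R : realType) (n : nat)
    (mu : set (n.-tuple (measurableTypeR R)) -> \bar R) : Prop :=
  exists (k : nat) (m : 'cV[R]_n) (A : 'M[R]_(n, k)),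
    forall B, measurable B ->
      mu B = pushforward (std_gaussian R k) (affine_tuple m A) B.

(* Processes are indexed by all of R, but only the times in [0, +oo[ are ever
   constrained or used. *)
Definition gaussian_process d (T : measurableType d) (R : realType)
    (P : probability T R) (X : R -> {RV P >-> R}) : Prop :=
  forall (n : nat) (t : 'I_n -> R), (forall i, 0 <= t i) ->
    multivariate_normal
      (pushforward P
        (fun w => [tuple X (t i) w | i < n] : n.-tuple (measurableTypeR R))).

Definition change_probability d (T : measurableType d) (R : realType)
    (P : probability T R) (X : R -> {RV P >-> R}) (tau : R) : R :=
  fine (P [set w | X 0 w < X tau w /\ X tau w >= X (2 * tau) w]) +
  fine (P [set w | X 0 w >= X tau w /\ X tau w < X (2 * tau) w]).

Definition hurst_map (R : realType) (x : R) : \bar R :=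
  if x == 1 then -oo%E
  else (1 + ln (sin (pi * (1 - x) / 2)) / ln 2)%:E.

Definition hurst_exponent_delay d (T : measurableType d) (R : realType)
    (P : probability T R) (X : R -> {RV P >-> R}) (tau : R) : \bar R :=
  hurst_map (change_probability X tau).

Definition increment_autocorrelation d (T : measurableType d) (R : realType)
    (P : probability T R) (X : R -> {RV P >-> R}) (tau : R) : R :=
  fine (covariance P (X (tau + 1) \- X tau) (X 1)) / fine 'V_P[X 1].

Definition is_hurst_exponent d (T : measurableType d) (R : realType)
    (P : probability T R) (X : R -> {RV P >-> R}) (h : R) : Prop :=
  exists2 l : R,
    ln `|increment_autocorrelation X tau| / ln tau @[tau --> +oo] --> l &
    h = 1 + 2^-1 * l.

(* Main.v *)
Require Import Defs.
From HB Require Import structures.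
From mathcomp Require Import all_boot all_order all_algebra.
From mathcomp Require Import all_classical all_reals all_analysis.
From mathcomp Require Import measurable_realfun ring lra.
Set Implicit Arguments.
Unset Strict Implicit.
Unset Printing Implicit Defensive.
Import Order.TTheory GRing.Theory Num.Theory.
Import numFieldNormedType.Exports.
Local Open Scope classical_set_scope.
Local Open Scope ring_scope.

(** The theorem rests on three facts.

    At an integer delay [n] the exponent is explicit: with [v n] the variance
    of [X n], [H(n) = log2 (v (2n) / v n) / 2].  Since [X 0] vanishes almost
    surely, a change occurs when the increments [X n] and [X (2n) - X n] have
    opposite signs.  They form a centered Gaussian pair, and stationarity of
    the unit increments gives them the same variance.  Such a pair has the law
    of [(al x, be x + ga y)] with [x], [y] independent standard normal
    ([std_gaussian_plane]), so that the event is a double plane sector, whose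
    probability is an arctangent ([std_plane_sector]).  The sine in [hurst_map]
    undoes the arctangent by a half-angle formula ([hurst_map_triangular]).

    The second difference of [v] at [n] is twice the covariance of unit
    increments at lag [n] ([kernel_diff2]), which is equivalent to a nonzero
    multiple of [n ^ (2H - 2)].  The limit cannot be negative, otherwise [v]
    would become negative.  Summing twice along the powers of two bounds
    [v (2 ^ j)] from below by a multiple of [Q ^ j], where [Q = 2 ^ (2H)], and
    from above by a multiple of [rho ^ j] for every [rho > Q].  Working with
    geometric rates only treats [H = 1/2], where a logarithm appears in [v],
    in the same way as [H > 1/2].

    Finally, if [H(tau) >= b] held for all large [tau], the ratios
    [v (2 ^ (j + 1)) / v (2 ^ j)] would eventually be at least [2 ^ (2b)], which
    the upper bound allows only for [b <= H]; the lower bound deals with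
    [H(tau) <= b].  These two implications ([eventually_hurst_ge],
    [eventually_hurst_le]) give both inequalities on the inferior and superior
    limits and the identification of a possible limit. *)

(** * Rotation invariance of Lebesgue measure in the plane *)

Section plane.
Context {R : realType}.
Notation RR := (measurableTypeR R).
Notation mu := (@lebesgue_measure R).
Notation N := (@normal_prob R 0 1).
Local Open Scope ereal_scope.

(** The Radon-Nikodym derivative of the normal law agrees almost everywhere
    with its density, since both have the same integral over every measurable
    set. *)
Lemma ge0_integral_std_normal (f : RR -> \bar R) :
  measurable_fun setT f -> (forall x, 0 <= f x) ->
  \int[N]_x f x = \int[mu]_x (f x * (normal_pdf 0 1 x)%:E).
Proof.
move=> mf f0.
have numu := @normal_prob_dominates R 0 1.
rewrite -(Radon_Nikodym_SigmaFinite.change_of_variables numu)//.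
have mN : measurable_fun setT (fun x : RR => (normal_pdf (0:R) 1 x)%:E).
  by apply/measurable_EFinP; exact: measurable_normal_pdf.
have iN := Radon_Nikodym_SigmaFinite.f_integrable numu.
apply: ae_eq_integral => //.
- by apply: emeasurable_funM => //; exact: (measurable_int mu).
- by apply: emeasurable_funM.
- apply: ae_eqe_mul2l; apply: integral_ae_eq => //.
  by move=> E _ mE; rewrite -Radon_Nikodym_SigmaFinite.f_integral.
Qed.

(** Both sides integrate against a measure which agrees with Lebesgue measure
    on intervals. *)
Lemma ge0_integral_lebesgue_shift (f : RR -> \bar R) (a : R) :
  measurable_fun setT f -> (forall x, 0 <= f x) ->
  \int[mu]_x f (x + a)%R = \int[mu]_x f x.
Proof.
move=> mf f0.
have ma : measurable_fun setT (fun x : RR => (x + a)%R : RR).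
  exact: measurable_funD.
transitivity (\int[pushforward mu (fun x : RR => (x + a)%R : RR)]_x f x).
  by rewrite ge0_integral_pushforward.
apply: eq_measure_integral => //= A mA _; apply/esym.
apply: lebesgue_measure_unique => //= _ [[b c] _ <-].
rewrite /pushforward /= (_ : _ @^-1` _ = `](b - a)%R, (c - a)%R]%classic); last first.
  by apply/seteqP; split => x /=; rewrite !in_itv/= ltrBlDr lerBrDr.
rewrite !lebesgue_measure_itv/= !lte_fin ltrD2r; case: ifP => // _.
by rewrite -!EFinB; congr EFin; ring.
Qed.

Definition integral_plane (f : RR * RR -> \bar R) :=
  \int[mu]_x \int[mu]_y f (x, y).

Lemma integral_plane_shear_r (f : RR * RR -> \bar R) (s : R) :
  measurable_fun setT f -> (forall z, 0 <= f z) ->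
  integral_plane (fun z => f (z.1, z.2 + s * z.1)%R) = integral_plane f.
Proof.
move=> mf f0; apply: eq_integral => x _ /=.
rewrite (@ge0_integral_lebesgue_shift (fun y => f (x, y)) (s * x)%R)//.
exact: measurableT_comp.
Qed.

Lemma integral_plane_shear_l (f : RR * RR -> \bar R) (s : R) :
  measurable_fun setT f -> (forall z, 0 <= f z) ->
  integral_plane (fun z => f (z.1 + s * z.2, z.2)%R) = integral_plane f.
Proof.
move=> mf f0; rewrite /integral_plane.
have mg : measurable_fun setT (fun z : RR * RR => (z.1 + s * z.2, z.2)%R : RR * RR).
  apply: measurable_fun_pair => //; apply: measurable_funD => //.
  exact: measurable_funM.
have mfg := measurableT_comp mf mg.
rewrite (@fubini_tonelli _ _ _ _ _ mu mu _ mfg); last by move=> z; exact: f0.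
rewrite [RHS](@fubini_tonelli _ _ _ _ _ mu mu _ mf f0).
apply: eq_integral => y _ /=.
rewrite (@ge0_integral_lebesgue_shift (fun x => f (x, y)) (s * y)%R)//.
exact: measurableT_comp.
Qed.

(** A rotation is a product of three shears, and each shear preserves
    iterated integrals by translation invariance in one variable.  The
    horizontal shears have parameter [- tan (theta / 2)], finite because [c
    >= 0]. *)
Lemma integral_plane_rotation (f : RR * RR -> \bar R) (c s : R) :
  measurable_fun setT f -> (forall z, 0 <= f z) ->
  (c ^+ 2 + s ^+ 2 = 1)%R -> (0 <= c)%R ->
  integral_plane (fun z => f (c * z.1 - s * z.2, s * z.1 + c * z.2)%R)
  = integral_plane f.
Proof.
move=> mf f0 cs c0.
have mshear_l (a : R) : measurable_fun setT
    (fun z : RR * RR => (z.1 + a * z.2, z.2)%R : RR * RR).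
  apply: measurable_fun_pair => //; apply: measurable_funD => //.
  exact: measurable_funM.
have mshear_r (a : R) : measurable_fun setT
    (fun z : RR * RR => (z.1, z.2 + a * z.1)%R : RR * RR).
  apply: measurable_fun_pair => //; apply: measurable_funD => //.
  exact: measurable_funM.
(* Minus the tangent of half the angle. *)
pose t : R := (- s / (1 + c))%R.
have c1 : (1 + c)%R != 0%R by rewrite gt_eqF// ltr_pwDl.
rewrite -[RHS](integral_plane_shear_l t mf f0).
rewrite -[RHS](@integral_plane_shear_r _ s); last 2 first.
- exact: (measurableT_comp mf (mshear_l t)).
- by [].
rewrite -[RHS](@integral_plane_shear_l _ t); last 2 first.
- exact: (measurableT_comp mf (measurableT_comp (mshear_l t) (mshear_r s))).
- by [].
congr integral_plane; apply/funext => -[x y] /=.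
have st : (1 + t * s = c)%R.
  apply: (mulfI c1); transitivity (1 + c - s ^+ 2)%R; first by rewrite /t; field.
  have -> : (s ^+ 2 = 1 - c ^+ 2)%R by rewrite -cs; ring.
  by ring.
have tc : (t + t * c = - s)%R.
  by rewrite -{1}(mulr1 t) -mulrDr /t divfK.
congr f; congr pair; last first.
  by rewrite -st; ring.
by rewrite -mulNr -tc -st; ring.
Qed.

End plane.

(** * Rotation invariance of the standard normal law in the plane *)

Section gaussian_plane.
Context {R : realType}.
Notation RR := (measurableTypeR R).
Notation mu := (@lebesgue_measure R).
Notation N := (@normal_prob R 0 1).
Local Open Scope ereal_scope.

Definition std_plane (f : RR * RR -> \bar R) := \int[N]_x \int[N]_y f (x, y).

Lemma measurable_std_normal_pdf :
  measurable_fun setT (fun x : RR => (normal_pdf (0:R) 1 x)%:E).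
Proof. by apply/measurable_EFinP; exact: measurable_normal_pdf. Qed.

Lemma std_plane_lebesgue (f : RR * RR -> \bar R) :
  measurable_fun setT f -> (forall z, 0 <= f z) ->
  std_plane f =
  integral_plane (fun z => f z * (normal_pdf 0 1 z.1 * normal_pdf 0 1 z.2)%:E).
Proof.
move=> mf f0; rewrite /std_plane ge0_integral_std_normal; last 2 first.
- exact: (measurable_fun_fubini_tonelli_F (m2 := N) _ mf).
- by move=> x; apply: integral_ge0.
apply: eq_integral => x _.
have mfx : measurable_fun setT (fun y : RR => f (x, y)).
  by apply: (measurableT_comp mf); exact: measurable_fun_pair.
rewrite ge0_integral_std_normal//.
rewrite -ge0_integralZr//; first last.
- by rewrite lee_fin normal_pdf_ge0.
- by move=> y _; rewrite mule_ge0// lee_fin normal_pdf_ge0.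
- by apply: emeasurable_funM => //; exact: measurable_std_normal_pdf.
by apply: eq_integral => y _ /=; rewrite -muleA -EFinM mulrC.
Qed.

Lemma std_normal_pdfE (x : R) :
  normal_pdf 0 1 x = ((Num.sqrt (pi *+ 2))^-1 * expR (- (x ^+ 2) / 2))%R.
Proof.
by rewrite normal_pdfE ?oner_eq0// /normal_peak /normal_fun subr0 expr1n mul1r.
Qed.

Lemma std_normal_pdf2E (x y : R) :
  (normal_pdf 0 1 x * normal_pdf 0 1 y =
   (pi *+ 2)^-1 * expR (- (x ^+ 2 + y ^+ 2) / 2))%R.
Proof.
rewrite !std_normal_pdfE mulrACA -expRD -invfM -expr2 sqr_sqrtr; last first.
  by rewrite mulrn_wge0// pi_ge0.
by congr (_ * expR _)%R; ring.
Qed.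

(** The density [exp (- (x ^ 2 + y ^ 2) / 2) / (2 pi)] depends on the
    distance to the origin only, so invariance is inherited from Lebesgue
    measure. *)
Lemma std_plane_rotation (f : RR * RR -> \bar R) (c s : R) :
  measurable_fun setT f -> (forall z, 0 <= f z) ->
  (c ^+ 2 + s ^+ 2 = 1)%R -> (0 <= c)%R ->
  std_plane (fun z => f (c * z.1 - s * z.2, s * z.1 + c * z.2)%R) = std_plane f.
Proof.
move=> mf f0 cs c0.
have mg : measurable_fun setT
    (fun z : RR * RR => (c * z.1 - s * z.2, s * z.1 + c * z.2)%R : RR * RR).
  by apply: measurable_fun_pair;
    [apply: measurable_funB|apply: measurable_funD]; exact: measurable_funM.
rewrite [RHS](std_plane_lebesgue mf f0).
apply: etrans; first exact: (std_plane_lebesgue (measurableT_comp mf mg) (fun z => f0 _)).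
have mw : measurable_fun setT
    (fun z : RR * RR => f z * (normal_pdf 0 1 z.1 * normal_pdf 0 1 z.2)%:E).
  apply: emeasurable_funM => //; apply/measurable_EFinP.
  by apply: measurable_funM; apply: measurableT_comp => //;
    exact: measurable_normal_pdf.
have w0 z : 0 <= f z * (normal_pdf 0 1 z.1 * normal_pdf 0 1 z.2)%:E.
  by rewrite mule_ge0// lee_fin mulr_ge0// normal_pdf_ge0.
rewrite -[RHS](integral_plane_rotation mw w0 cs c0).
congr integral_plane; apply/funext => -[x y] /=; congr (_ * _%:E).
rewrite [LHS]std_normal_pdf2E.
have -> : (x ^+ 2 + y ^+ 2 = (c * x - s * y) ^+ 2 + (s * x + c * y) ^+ 2)%R.
  by rewrite -[LHS]mul1r -cs; ring.
by rewrite -std_normal_pdf2E.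
Qed.

Lemma measurable_linear_pair (a b c d : R) :
  measurable_fun setT
    (fun z : RR * RR => (a * z.1 + b * z.2, c * z.1 + d * z.2)%R : RR * RR).
Proof.
by apply: measurable_fun_pair; apply: measurable_funD; exact: measurable_funM.
Qed.

(** Two linear forms in [(x, y)] can be rotated so that the first one depends
    on a single coordinate; its coefficient is the norm of the original form. *)
Lemma std_plane_triangular (a p b q : R) : (0 <= p)%R ->
  exists u w : R, forall f : RR * RR -> \bar R,
    measurable_fun setT f -> (forall z, 0 <= f z) ->
  std_plane (fun z => f (a * z.1 + p * z.2, b * z.1 + q * z.2)%R) =
  std_plane (fun z => f (Num.sqrt (a ^+ 2 + p ^+ 2) * z.2, u * z.1 + w * z.2)%R).
Proof.
move=> p0; have ap0 : (0 <= a ^+ 2 + p ^+ 2)%R by rewrite addr_ge0// sqr_ge0.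
have [/eqP|r0] := eqVneq (a ^+ 2 + p ^+ 2)%R 0%R.
  rewrite paddr_eq0 ?sqr_ge0// !sqrf_eq0 => /andP[/eqP-> /eqP->].
  exists b, q => f mf f0; congr std_plane; apply/funext => z.
  by congr f; congr pair; rewrite expr0n/= addr0 sqrtr0 !mul0r addr0.
set r := Num.sqrt _.
have rr : (r ^+ 2 = a ^+ 2 + p ^+ 2)%R by rewrite sqr_sqrtr.
have rpos : (0 < r)%R by rewrite sqrtr_gt0 lt0r r0.
have rn0 : (r != 0)%R by rewrite gt_eqF.
pose c := (p / r)%R; pose s := (a / r)%R.
have cs : (c ^+ 2 + s ^+ 2 = 1)%R.
  by rewrite /c /s !expr_div_n -mulrDl addrC -rr divff// expf_neq0.
exists (b * c - q * s)%R, (b * s + q * c)%R => f mf f0.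
have c0 : (0 <= c)%R by rewrite divr_ge0// ltW.
have mg : measurable_fun setT (fun z : RR * RR =>
    f (r * z.2, (b * c - q * s) * z.1 + (b * s + q * c) * z.2)%R).
  have := measurable_linear_pair 0 r (b * c - q * s) (b * s + q * c).
  move=> /(measurableT_comp mf) /=; apply: eq_measurable_fun => z _ /=.
  by rewrite mul0r add0r.
rewrite -[RHS](std_plane_rotation mg (fun _ => f0 _) cs c0).
congr std_plane; apply/funext => z; congr f; congr pair => /=.
  by rewrite /c /s; field.
transitivity (1 * (b * z.1 + q * z.2))%R; first by rewrite mul1r.
by rewrite -cs; ring.
Qed.

(** A linear form of a standard normal vector is normal with standard
    deviation the norm of the form. *)
Lemma std_plane_line (u v : R) (g : RR -> \bar R) : (0 <= v)%R ->
  measurable_fun setT g -> (forall x, 0 <= g x) ->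
  std_plane (fun z => g (u * z.1 + v * z.2)%R) =
  \int[N]_x g (Num.sqrt (u ^+ 2 + v ^+ 2) * x)%R.
Proof.
move=> v0 mg g0; have [u' [w' H]] := std_plane_triangular u 0 0 v0.
have mg1 : measurable_fun setT (fun z : RR * RR => g z.1).
  exact: measurableT_comp.
rewrite (H (fun z => g z.1))//= /std_plane/=.
by rewrite integral_cst// -[X in _ * X]/(N setT) probability_setT mule1.
Qed.

End gaussian_plane.

(** * Reduction of a Gaussian vector to two coordinates *)

Section reduction.
Context {R : realType}.
Notation RR := (measurableTypeR R).
Notation N := (@normal_prob R 0 1).
Local Open Scope ereal_scope.

Lemma ge0_integral_std_gaussianS (k : nat) (g : k.+1.-tuple RR -> \bar R) :
  measurable_fun setT g -> (forall z, 0 <= g z) ->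
  \int[std_gaussian R k.+1]_z g z =
  \int[N]_x \int[std_gaussian R k]_z g (tuple_cons (x, z)).
Proof.
move=> mg g0; rewrite /= ge0_integral_pushforward//=.
have mgt := measurableT_comp mg (@measurable_tuple_cons R k).
rewrite preimage_setT.
by apply: (fubini_tonelli1 _ mgt) => z; exact: g0.
Qed.

Lemma measurable_linear_form (k : nat) (a : 'I_k -> R) :
  measurable_fun setT
    (fun z : k.-tuple RR => (\sum_(i < k) a i * tnth z i)%R : RR).
Proof.
apply: measurable_sum => i; apply: measurable_funM => //.
exact: measurable_tnth.
Qed.

Definition iter3 (h : RR -> RR -> RR -> \bar R) :=
  \int[N]_x \int[N]_y \int[N]_z h x y z.

Definition measurable3 (h : RR -> RR -> RR -> \bar R) :=
  measurable_fun setT (fun t : (RR * RR) * RR => h t.1.1 t.1.2 t.2).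

Lemma measurable3_swap12 h : measurable3 h -> measurable3 (fun y x z => h x y z).
Proof.
move=> mh.
have mp : measurable_fun setT
    (fun t : (RR * RR) * RR => ((t.1.2, t.1.1), t.2) : (RR * RR) * RR).
  apply: measurable_fun_pair => //; apply: measurable_fun_pair;
  exact: measurableT_comp.
exact: (measurableT_comp mh mp).
Qed.

Lemma measurable3_swap23 h : measurable3 h -> measurable3 (fun x z y => h x y z).
Proof.
move=> mh.
have mp : measurable_fun setT
    (fun t : (RR * RR) * RR => ((t.1.1, t.2), t.1.2) : (RR * RR) * RR).
  by apply: measurable_fun_pair; [apply: measurable_fun_pair => //|];
  exact: measurableT_comp.
exact: (measurableT_comp mh mp).
Qed.

Lemma iter3_swap12 h : measurable3 h -> (forall x y z, 0 <= h x y z) ->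
  iter3 h = iter3 (fun y x z => h x y z).
Proof.
move=> mh h0.
have mg := measurable_fun_fubini_tonelli_F (m2 := N) _ mh (fun t => h0 _ _ _).
apply: (@fubini_tonelli _ _ _ _ _ N N _ mg) => z.
by apply: integral_ge0.
Qed.

Lemma iter3_swap23 h : measurable3 h -> (forall x y z, 0 <= h x y z) ->
  iter3 h = iter3 (fun x z y => h x y z).
Proof.
move=> mh h0; apply: eq_integral => x _.
have mx : measurable_fun setT (fun u : RR * RR => ((x, u.1), u.2) : (RR * RR) * RR).
  by apply: measurable_fun_pair => //; exact: measurable_fun_pair.
by apply: (@fubini_tonelli _ _ _ _ _ N N _ (measurableT_comp mh mx)) => z; exact: h0.
Qed.

Lemma measurable_linear_triple (a b c a' b' c' : R) :
  measurable_fun setT (fun t : (RR * RR) * RR =>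
    (a * t.1.1 + b * t.1.2 + c * t.2,
     a' * t.1.1 + b' * t.1.2 + c' * t.2)%R : RR * RR).
Proof.
have m1 : measurable_fun setT (fun t : (RR * RR) * RR => t.1.1).
  exact: (measurableT_comp measurable_fst measurable_fst).
have m2 : measurable_fun setT (fun t : (RR * RR) * RR => t.1.2).
  exact: (measurableT_comp measurable_snd measurable_fst).
by apply: measurable_fun_pair; apply: measurable_funD;
  [apply: measurable_funD|exact: measurable_funM|apply: measurable_funD|
   exact: measurable_funM]; exact: measurable_funM.
Qed.

(** A third Gaussian variable is absorbed by two rotations: one in the plane
    of [x], [y], which reduces the first form to a single coordinate, and one
    in the plane of [z] and the coordinate that the first form no longer
    sees.  This is the induction step of the reduction of [k] coordinates to
    two. *)
Lemma triple_normal_reduction (a b al be ga : R) : (0 <= al)%R -> (0 <= ga)%R ->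
  exists al' be' ga' : R, [/\ (0 <= al')%R, (0 <= ga')%R &
    forall f : RR * RR -> \bar R, measurable_fun setT f -> (forall z, 0 <= f z) ->
    \int[N]_x \int[N]_y \int[N]_z
      f (a * x + al * y + 0 * z, b * x + be * y + ga * z)%R =
    std_plane (fun z => f (al' * z.1, be' * z.1 + ga' * z.2)%R)].
Proof.
move=> al0 ga0.
have [u [w Huw]] := std_plane_triangular a b be al0.
set al' := Num.sqrt _ in Huw.
exists al', w, (Num.sqrt (u ^+ 2 + ga ^+ 2)).
split; [exact: sqrtr_ge0|exact: sqrtr_ge0|move=> f mf f0].
pose M (c1 c2 c3 d1 d2 d3 : R) :=
  measurableT_comp mf (measurable_linear_triple c1 c2 c3 d1 d2 d3).
pose h x y z := f (a * x + al * y + 0 * z, b * x + be * y + ga * z)%R.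
have mh : measurable3 h := M a al 0%R b be ga.
have h0 x y z : 0 <= h x y z := f0 _.
(* Integrate over [z] last, so that [x] and [y] can be rotated with [z] fixed. *)
rewrite -/(iter3 h) (iter3_swap23 mh h0).
have mh' := measurable3_swap23 mh.
rewrite (iter3_swap12 mh' (fun _ _ _ => h0 _ _ _)).
pose h' z x y := f (al' * y + 0 * x + 0 * z, w * y + u * x + ga * z)%R.
transitivity (iter3 h').
  apply: eq_integral => z _.
  have mz : measurable_fun setT (fun t : RR * RR => f (t.1, t.2 + ga * z)%R).
    apply: (measurableT_comp mf); apply: measurable_fun_pair => //.
    exact: measurable_funD.
  have /= := Huw _ mz (fun t => f0 _).
  rewrite /std_plane/= => E; transitivity (\int[N]_x \int[N]_y
     f (a * x + al * y, b * x + be * y + ga * z)%R).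
    apply: eq_integral => x _; apply: eq_integral => y _.
    by rewrite /h mul0r addr0.
  rewrite E; apply: eq_integral => x _; apply: eq_integral => y _.
  by rewrite /h' !mul0r !addr0 [(w * y + _)%R]addrC.
(* Integrate over [y], which the first form still sees, last: [x] and [z] are
   left and merge into one variable. *)
pose h'' y x z := f (al' * y + 0 * x + 0 * z, w * y + u * x + ga * z)%R.
have mh'' : measurable3 h'' := M al' 0%R 0%R w u ga.
have h''0 x y z : 0 <= h'' x y z := f0 _.
have mh2 := measurable3_swap23 mh''.
have mh3 := measurable3_swap12 mh2.
transitivity (iter3 h'').
  apply/esym; rewrite (iter3_swap23 mh'' h''0).
  rewrite (iter3_swap12 mh2 (fun _ _ _ => h''0 _ _ _)).
  exact: (iter3_swap23 mh3 (fun _ _ _ => h''0 _ _ _)).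
apply: eq_integral => y _.
have my : measurable_fun setT (fun t : RR => f (al' * y, w * y + t)%R).
  by apply: (measurableT_comp mf); apply: measurable_fun_pair => //;
    exact: measurable_funD.
rewrite /= -(std_plane_line u ga0 my (fun t => f0 _)).
apply: eq_integral => x _; apply: eq_integral => z _ /=.
by rewrite /h'' !mul0r !addr0 addrA.
Qed.

(** The joint law of two linear forms of a standard normal vector is
    determined by a triangular two by two matrix, however many coordinates
    the vector has: coordinates are absorbed one at a time. *)
Lemma std_gaussian_plane (k : nat) (a b : 'I_k -> R) :
  exists al be ga : R, [/\ (0 <= al)%R, (0 <= ga)%R &
    forall f : RR * RR -> \bar R, measurable_fun setT f -> (forall z, 0 <= f z) ->
    \int[std_gaussian R k]_z f (\sum_(i < k) a i * tnth z i,
                                \sum_(i < k) b i * tnth z i)%R =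
    std_plane (fun z => f (al * z.1, be * z.1 + ga * z.2)%R)].
Proof.
have N1 (c : \bar R) : \int[N]_x cst c x = c.
  by rewrite integral_cst// -[X in _ * X]/(N setT) probability_setT mule1.
have mk (j : nat) (c d : 'I_j -> R) (f : RR * RR -> \bar R) :
  measurable_fun setT f -> measurable_fun setT (fun z : j.-tuple RR =>
    f (\sum_(i < j) c i * tnth z i, \sum_(i < j) d i * tnth z i)%R).
  move=> mf; apply: (measurableT_comp mf).
  by apply: measurable_fun_pair; exact: measurable_linear_form.
elim: k a b => [|k IH] a b.
  exists 0%R, 0%R, 0%R; split => // f mf f0; rewrite /=.
  rewrite integral_dirac//=; last exact: mk.
  rewrite !big_ord0 diracT mul1e /std_plane/=.
  under eq_integral do under eq_integral do rewrite !mul0r addr0.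
  by under eq_integral do rewrite N1; rewrite N1.
have [al [be [ga [al0 ga0 {}IH]]]] :=
  IH (fun i => a (lift ord0 i)) (fun i => b (lift ord0 i)).
have [al' [be' [ga' [al'0 ga'0 H]]]] :=
  triple_normal_reduction (a ord0) (b ord0) be al0 ga0.
exists al', be', ga'; split; [exact: al'0|exact: ga'0|move=> f mf f0].
rewrite (ge0_integral_std_gaussianS (mk _ a b f mf) (fun t => f0 _)).
rewrite -(H f mf f0); apply: eq_integral => x _.
have mx : measurable_fun setT
    (fun t : RR * RR => f (a ord0 * x + t.1, b ord0 * x + t.2)%R).
  by apply: (measurableT_comp mf); apply: measurable_fun_pair;
    exact: measurable_funD.
have /= := IH _ mx (fun t => f0 _).
set I1 := integral _ _ _; set I2 := std_plane _ => E.
transitivity I1.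
  apply: eq_integral => z _ /=; congr f.
  rewrite !big_ord_recl; congr pair; congr (_ + _)%R.
  - by apply: eq_bigr => i _; rewrite !(tnth_nth 0%R).
  - by apply: eq_bigr => i _; rewrite !(tnth_nth 0%R).
rewrite E; apply: eq_integral => y _; apply: eq_integral => z _ /=.
by rewrite mul0r addr0 addrA.
Qed.

End reduction.

(** * One-dimensional integrals *)

Section one_dim.
Context {R : realType}.
Notation RR := (measurableTypeR R).
Notation mu := (@lebesgue_measure R).
Local Open Scope ereal_scope.

(** The integrand has primitive [- exp (- x ^ 2 A / 2) / A]. *)
Lemma integral_radial (A : R) : (0 < A)%R ->
  \int[mu]_(x in `[0%R, +oo[) (x * expR (- (x ^+ 2 * A / 2)))%:E = (A^-1)%:E.
Proof.
move=> A0; pose F (x : R) := (- A^-1 * expR (- (x ^+ 2 * A / 2)))%R.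
have dF (x : R) : is_derive x 1%R F (x * expR (- (x ^+ 2 * A / 2)))%R.
  apply: is_derive_eq.
  by rewrite /GRing.scale/=; field; rewrite gt_eqF.
have cF : continuous F.
  by move=> x; apply/differentiable_continuous/derivable1_diffP; apply: ex_derive.
rewrite (@ge0_continuous_FTC2y _ _ F 0%R 0%R).
- by rewrite /F expr0n/= !mul0r oppr0 expR0 mulr1 -EFinD sub0r opprK.
- by move=> x x0; rewrite mulr_ge0// expR_ge0.
- apply: continuous_subspaceT => x.
  apply/differentiable_continuous/derivable1_diffP.
  exact: ex_derive.
- rewrite /F -[X in _ --> X](mulr0 (- A^-1)%R).
  apply: cvgM; first exact: cvg_cst.
  apply: (cvg_comp (fun x : R => x ^+ 2 * A / 2)%R (fun x => expR (- x))%R _ (@cvgr_expR R)).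
  apply: gt0_cvgMly; first by rewrite invr_gt0.
  apply: gt0_cvgMly => //.
  apply/cvgryPge => B; near=> x.
  have : (1 <= x)%R by near: x; apply: nbhs_pinfty_ge; rewrite num_real.
  have : (B <= x)%R by near: x; apply: nbhs_pinfty_ge; rewrite num_real.
  nra.
- by move=> x x0; exact: ex_derive.
- by apply: cvg_at_right_filter; exact: cF.
- by move=> x _; rewrite derive1E derive_val.
Unshelve. all: by end_near. Qed.

Lemma integral_Ny_oneDsqr (t : R) :
  \int[mu]_(s in `]-oo, t]) ((1 + s ^+ 2)^-1)%:E = (atan t + pi / 2)%:E.
Proof.
have cf : continuous (fun s : R => (1 + s ^+ 2)^-1)%R.
  exact: continuous_oneDsqrV.
rewrite -{1}(opprK t) ge0_integration_by_substitutionNy; last 2 first.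
- exact: continuous_subspaceT.
- by move=> x _; rewrite invr_ge0 addr_ge0// sqr_ge0.
under eq_integral do rewrite /= sqrrN.
rewrite (ge0_continuous_FTC2y _ _ (@cvgy_atan R)).
- by rewrite atanN -EFinN opprK -EFinD addrC.
- by move=> x _; rewrite invr_ge0 addr_ge0// sqr_ge0.
- exact: continuous_subspaceT.
- by move=> x x0; apply: ex_derive.
- by apply: cvg_at_right_filter; exact: continuous_atan.
- by move=> x _; rewrite derive1E; exact: derive_val.
Qed.

Lemma integral_Ny_scale (G : R -> R) (x t : R) : (0 < x)%R ->
  continuous G -> (forall y, 0 <= G y)%R ->
  \int[mu]_(y in `]-oo, (t * x)%R]) (G y)%:E =
  \int[mu]_(s in `]-oo, t]) (G (s * x) * x)%:E.
Proof.
move=> x0 cG G0; pose F (s : R) := (s * x)%R.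
have dF (s : R) : is_derive s 1%R F x.
  by apply: is_derive_eq; rewrite /GRing.scale/=; ring.
have F'E : (F^`())%classic = cst x.
  by apply/funext => s; rewrite derive1E derive_val.
have cF : continuous F.
  by move=> s; apply/differentiable_continuous/derivable1_diffP; apply: ex_derive.
rewrite -/(F t) increasing_ge0_integration_by_substitutionNy.
- by rewrite F'E.
- by move=> a b _ _ ab; rewrite /F ltr_pM2r.
- by rewrite F'E => ? _; exact: cst_continuous.
- by rewrite F'E; exact: is_cvg_cst.
- by rewrite F'E; exact: cvg_cst.
- by split; [move=> ? _; exact: ex_derive|apply: cvg_at_left_filter; exact: cF].
- by apply: gt0_cvgMlNy.
- exact: continuous_subspaceT.
- by [].
Qed.
End one_dim.

(** * Probability of a sector *)

Section sector.
Context {R : realType}.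
Notation RR := (measurableTypeR R).
Notation mu := (@lebesgue_measure R).
Notation N := (@normal_prob R 0 1).
Local Open Scope ereal_scope.

Definition sector (t : R) : set (RR * RR) := [set z | 0 < z.1 /\ z.2 <= t * z.1]%R.

Lemma measurable_sector t : measurable (sector t).
Proof.
have -> : sector t = (fst @^-1` `]0%R, +oo[%classic) `&`
    ((fun z : RR * RR => (t * z.1 - z.2)%R : RR) @^-1` `[0%R, +oo[%classic).
  by apply/seteqP; split => z /=; rewrite /sector/= !in_itv/= !andbT subr_ge0.
apply: measurableI.
- rewrite -[X in measurable X]setTI.
  by apply: (@measurable_fst _ _ RR RR); [exact: measurableT|exact: measurable_itv].
- rewrite -[X in measurable X]setTI.
  have m : measurable_fun setT (fun z : RR * RR => (t * z.1 - z.2)%R : RR).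
    by apply: measurable_funB => //; exact: measurable_funM.
  by apply: m; [exact: measurableT|exact: measurable_itv].
Qed.

(** In the coordinates [(x, s)] with [y = s x], the density of the standard
    normal law times the Jacobian [x] integrates over [x > 0] to [1 / (2 pi
    (1 + s ^ 2))]; integrating over the slopes [s <= t] gives the arctangent. *)
Lemma std_plane_sector (t : R) :
  std_plane (fun z => (\1_(sector t) z)%:E) =
  ((pi *+ 2)^-1 * (atan t + pi / 2))%:E.
Proof.
have mS := measurable_sector t.
have f0 (z : RR * RR) : 0 <= (\1_(sector t) z)%:E :> \bar R by rewrite lee_fin.
have mf : measurable_fun setT (fun z => (\1_(sector t) z)%:E : \bar R).
  by apply/measurable_EFinP; exact: measurable_indic.
rewrite (std_plane_lebesgue mf f0) /integral_plane /=.
pose K (x s : R) := ((pi *+ 2)^-1 * (x * expR (- (x ^+ 2 * (1 + s ^+ 2) / 2))))%R.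
pose h (z : RR * RR) : \bar R :=
  (\1_(`]0%R, +oo[%classic : set RR) z.1 *
   \1_(`]-oo, t]%classic : set RR) z.2 * K z.1 z.2)%:E.
(* Change of variable [y = s * x] on the half-line [y <= t * x], for [x > 0]. *)
transitivity (\int[mu]_x \int[mu]_s h (x, s)).
  apply: eq_integral => x _; have [x0|x0] := ltP 0%R x; last first.
    transitivity (\int[mu]_y (cst 0 y)).
      apply: eq_integral => y _; rewrite indicE memNset ?mul0e//.
      by move=> [] /=; rewrite ltNge x0.
    apply: eq_integral => y _; rewrite /h/= indicE memNset ?mul0r//=.
    by rewrite in_itv/= andbT ltNge x0.
  transitivity (\int[mu]_(y in `]-oo, (t * x)%R])
      ((normal_pdf 0 1 x * normal_pdf 0 1 y)%:E)).
    rewrite [RHS]integral_mkcond; apply: eq_integral => y _.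
    rewrite patchE indicE mem_setE in_itv/=; case: (leP y) => yx.
      by rewrite mem_set// mul1e.
    by rewrite memNset ?mul0e//= => -[] /=; rewrite leNgt yx.
  rewrite (@integral_Ny_scale _ (fun y => normal_pdf 0 1 x * normal_pdf 0 1 y)%R)//.
  - rewrite integral_mkcond; apply: eq_integral => s _.
    rewrite patchE /h/= !indicE !mem_setE !in_itv/= x0 /= mul1r.
    case: (leP s) => st; last by rewrite mul0r.
    rewrite mul1r [X in (X * x)%R]std_normal_pdf2E /K; congr EFin.
    have -> : (- (x ^+ 2 + (s * x) ^+ 2) / 2 = - (x ^+ 2 * (1 + s ^+ 2) / 2))%R.
      by field.
    by ring.
  - move=> y; apply: cvgM; first exact: cvg_cst.
    by apply: continuous_normal_pdf; rewrite oner_neq0.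
  - by move=> y; rewrite mulr_ge0// normal_pdf_ge0.
have mh : measurable_fun setT h.
  apply/measurable_EFinP; apply: measurable_funM.
    apply: measurable_funM.
      by apply: measurableT_comp => //; exact: measurable_indic.
    by apply: measurableT_comp => //; exact: measurable_indic.
  apply: measurable_funM => //; apply: measurable_funM => //.
  apply: measurableT_comp => //; apply: measurableT_comp => //.
  apply: measurable_funM => //; apply: measurable_funM.
    by apply: measurable_funX.
  by apply: measurable_funD => //; apply: measurable_funX.
have h0 z : 0 <= h z.
  rewrite /h !indicE mem_setE in_itv/= andbT lee_fin.
  have [z0|z0] := ltP 0%R z.1; last by rewrite !mul0r.
  rewrite mul1r mulr_ge0// /K mulr_ge0//.
    by rewrite invr_ge0 mulrn_wge0// pi_ge0.
  by rewrite mulr_ge0// ?expR_ge0// ltW.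
(* The slope [s] becomes the outer variable. *)
rewrite (@fubini_tonelli _ _ _ _ _ mu mu _ mh h0).
transitivity (\int[mu]_(s in `]-oo, t]) ((pi *+ 2)^-1%:E * ((1 + s ^+ 2)^-1)%:E)).
  rewrite [RHS]integral_mkcond; apply: eq_integral => s _.
  rewrite patchE mem_setE in_itv/=; case: (leP s) => st; last first.
    transitivity (\int[mu]_y (cst 0 y)); last by rewrite integral0.
    apply: eq_integral => x _; rewrite /h/=.
    rewrite [in X in (_ * X * _)%R]indicE memNset ?mulr0 ?mul0r//=.
    by rewrite in_itv/= leNgt st.
  have s1 : (0 < 1 + s ^+ 2)%R by rewrite ltr_pwDl// sqr_ge0.
  have mrad : measurable_fun setT
      (fun x : RR => (x * expR (- (x ^+ 2 * (1 + s ^+ 2) / 2)))%:E).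
    apply/measurable_EFinP; apply: measurable_funM => //.
    apply: measurableT_comp => //; apply: measurableT_comp => //.
    by apply: measurable_funM => //; apply: measurable_funM.
  rewrite -(integral_radial s1) -ge0_integralZl//; last 3 first.
  - exact: measurable_funTS.
  - move=> x; rewrite /= in_itv/= andbT => x0.
    by rewrite lee_fin mulr_ge0// expR_ge0.
  - by rewrite lee_fin invr_ge0 mulrn_wge0// pi_ge0.
  rewrite -integral_itv_obnd_cbnd; last first.
    apply: measurable_funTS; apply: emeasurable_funM => //.
  rewrite [RHS]integral_mkcond; apply: eq_integral => x _.
  rewrite patchE /h/= !indicE !mem_setE !in_itv/= st andbT mulr1.
  by case: ltP => x0; rewrite ?mul1r ?mul0r// /K EFinM.
rewrite ge0_integralZl//.
- by rewrite integral_Ny_oneDsqr -EFinM.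
- apply: measurable_funTS; apply/measurable_EFinP.
  by apply: continuous_measurable_fun; exact: continuous_oneDsqrV.
- by move=> s _; rewrite lee_fin invr_ge0 addr_ge0// sqr_ge0.
- by rewrite lee_fin invr_ge0 mulrn_wge0// pi_ge0.
Qed.
End sector.

(** * Change probability of a Gaussian pair *)

Section change.
Context {R : realType}.
Notation RR := (measurableTypeR R).
Notation mu := (@lebesgue_measure R).
Notation N := (@normal_prob R 0 1).

Lemma ae_std_normal_neq (a : R) : {ae N, forall x : RR, x != a}.
Proof.
have ma : measurable ([set a] : set RR) by exact: measurable_set1.
exists [set a]; split => //.
  have /null_content_dominatesP := @normal_prob_dominates R 0 1.
  by apply => //; exact: lebesgue_measure_set1.
by move=> x /= /negP; rewrite negbK => /eqP.
Qed.

(** The standard normal law charges no point, hence the plane law charges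
    neither the axis [x = 0] nor a line [y = t x]: these are the boundaries
    of the sectors below. *)
Lemma std_plane_ae_eq (t : R) (f g : RR * RR -> \bar R) :
  measurable_fun setT f -> (forall z, 0 <= f z)%E ->
  measurable_fun setT g -> (forall z, 0 <= g z)%E ->
  (forall x y, x != 0 -> y != t * x -> f (x, y) = g (x, y)) ->
  std_plane f = std_plane g.
Proof.
move=> mf f0 mg g0 fg; apply: ae_eq_integral => //.
- exact: (measurable_fun_fubini_tonelli_F (m2 := N) _ mf).
- exact: (measurable_fun_fubini_tonelli_F (m2 := N) _ mg).
have mx (h : RR * RR -> \bar R) x : measurable_fun setT h ->
    measurable_fun setT (fun y : RR => h (x, y)).
  by move=> mh; apply: (measurableT_comp mh); exact: measurable_fun_pair.
apply: filterS (ae_std_normal_neq 0) => x x0 _.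
apply: ae_eq_integral => //; [exact: mx|exact: mx|].
by apply: filterS (ae_std_normal_neq (t * x)) => y yt _; exact: fg.
Qed.

(** The central symmetry is the square of the rotation by a right angle. *)
Lemma std_plane_opp (f : RR * RR -> \bar R) :
  measurable_fun setT f -> (forall z, 0 <= f z)%E ->
  std_plane (fun z => f (- z.1, - z.2)) = std_plane f.
Proof.
move=> mf f0; have c1 : (0 : R) ^+ 2 + 1 ^+ 2 = 1 by rewrite expr0n/= expr1n add0r.
rewrite -[RHS](std_plane_rotation mf f0 c1 (lexx _)).
have mg : measurable_fun setT
    (fun z : RR * RR => f (0 * z.1 - 1 * z.2, 1 * z.1 + 0 * z.2)).
  apply: (measurableT_comp mf); apply: measurable_fun_pair.
    by apply: measurable_funB; exact: measurable_funM.
  by apply: measurable_funD; exact: measurable_funM.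
rewrite -[RHS](std_plane_rotation mg (fun _ => f0 _) c1 (lexx _)).
congr std_plane; apply/funext => z /=; congr f; congr pair; ring.
Qed.


(** The value [2^-1 + atan t / pi] is twice the probability of a sector of
    slope [t], the angle is [pi / 4 - atan t / 2], and the square of its sine
    follows from the double-angle formula. *)
Lemma sin_sector_sqr (t : R) :
  let a := pi * (1 - (2^-1 + atan t / pi)) / 2 in
  0 < sin a /\ sin a ^+ 2 = (1 - t / Num.sqrt (1 + t ^+ 2)) / 2.
Proof.
move=> a; have pi0 : (pi : R) != 0 := lt0r_neq0 (pi_gt0 R).
have aE : a *+ 2 = - (atan t - pi / 2).
  by rewrite /a -mulr_natr; move: (pi : R) pi0 => p p0; field.
have [lt1 lt2] : - (pi / 2) < atan t /\ atan t < pi / 2.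
  by split; [exact: atan_gtNpi2|exact: atan_ltpi2].
split.
  rewrite sin_gt0_pihalf//; have : a *+ 2 = a + a by rewrite mulr2n.
  rewrite aE; have := @pi_gt0 R; lra.
have sat : sin (atan t) = t / Num.sqrt (1 + t ^+ 2).
  have c0 : cos (atan t) != 0 by rewrite gt_eqF// cos_gt0_pihalf// lt1.
  by rewrite -cos_atan; exact: (canRL (divfK c0) (atanK t)).
have := cos_mulr2n a; rewrite aE cosN cosBpihalf cos2sin2 sat mulr2n => ->.
by field.
Qed.

Lemma measurable_linear_itv (a b : R) (i : interval R) :
  measurable ((fun z : RR * RR => a * z.1 + b * z.2) @^-1` [set` i]).
Proof.
rewrite -[X in measurable X]setTI.
have m : measurable_fun setT (fun z : RR * RR => (a * z.1 + b * z.2)%R : RR).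
  by apply: measurable_funD; exact: measurable_funM.
by apply: m; [exact: measurableT|exact: measurable_itv].
Qed.

(** The two events are opposite sectors, up to null sets, of slope [(al - be)
    / ga].  Their common probability makes the sine in [hurst_map] the square
    root of [be / (2 al)], a quarter of the variance ratio.  The degenerate
    case [ga = 0] leaves only the perfectly correlated pair, where both
    events are empty. *)
Lemma hurst_map_triangular (al be ga : R) : 0 < al -> 0 <= ga ->
  (be - al) ^+ 2 + ga ^+ 2 = al ^+ 2 -> 0 < be ^+ 2 + ga ^+ 2 ->
  hurst_map
    (fine (std_plane (fun z : RR * RR =>
       (\1_[set z : RR * RR | 0 < al * z.1 /\ be * z.1 + ga * z.2 <= al * z.1] z)%:E)) +
     fine (std_plane (fun z : RR * RR =>
       (\1_[set z : RR * RR | al * z.1 <= 0 /\ al * z.1 < be * z.1 + ga * z.2] z)%:E))) =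
  (ln ((be ^+ 2 + ga ^+ 2) / al ^+ 2) / ln 2 / 2)%:E.
Proof.
move=> al0 ga0 eqa pos.
have ln2 : ln 2 != 0 :> R by rewrite gt_eqF// ln_gt0// ltr1n.
have half_pi (p x : R) : p != 0 -> 2^-1 + x / p = 1 -> x = p / 2.
  by move=> p0 h; apply: (mulIf (invr_neq0 p0)); rewrite mulrAC divff// mul1r; lra.
have ratioE : be ^+ 2 + ga ^+ 2 = 2 * al * be.
  by apply/eqP; rewrite -subr_eq0; apply/eqP; move: eqa; rewrite sqrrB; lra.
have be0 : 0 < be by move: pos; rewrite ratioE pmulr_rgt0// mulr_gt0.
have rE : (be ^+ 2 + ga ^+ 2) / al ^+ 2 = 4 * (be / (2 * al)).
  by rewrite ratioE; field; rewrite gt_eqF.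
rewrite rE lnM ?posrE//; last by rewrite divr_gt0// mulr_gt0.
have ln4 : ln 4 = 2 * ln 2 :> R.
  by rewrite mulr_natl -lnXn// (_ : 2 ^+ 2 = 4)// -natrX.
have [ga_eq0|ga_neq0] := eqVneq ga 0.
  have beE : be = 2 * al.
    apply/eqP; rewrite -subr_eq0; move: ratioE; rewrite ga_eq0 expr0n/= addr0.
    move/eqP; rewrite -subr_eq0 expr2 -mulrBl mulf_eq0 => /orP[//|].
    by rewrite gt_eqF.
  have E0 (S : set (RR * RR)) : S = set0 ->
      fine (std_plane (fun z : RR * RR => (\1_S z)%:E)) = 0.
    move=> ->; rewrite /std_plane.
    under eq_integral do under eq_integral do rewrite indicE in_set0.
    under eq_integral do rewrite integral0.
    by rewrite integral0.
  have noA1 : [set z : RR * RR | 0 < al * z.1 /\ be * z.1 + ga * z.2 <= al * z.1]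
      = set0.
    by apply/seteqP; split => z // -[/=]; rewrite ga_eq0 beE mul0r addr0; lra.
  have noA2 : [set z : RR * RR | al * z.1 <= 0 /\ al * z.1 < be * z.1 + ga * z.2]
      = set0.
    by apply/seteqP; split => z // -[/=]; rewrite ga_eq0 beE mul0r addr0; lra.
  rewrite (congr2 (fun x y => hurst_map (x + y)) (E0 _ noA1) (E0 _ noA2)).
  rewrite /hurst_map addr0 eq_sym oner_eq0 subr0 mulr1 sin_pihalf ln1 mul0r addr0.
  congr EFin; rewrite beE divff ?ln1; last by rewrite gt_eqF// mulr_gt0.
  by rewrite addr0 ln4; move: (ln 2) ln2 => l l0; field.
have ga_gt0 : 0 < ga by rewrite lt_def ga_neq0.
pose t := (al - be) / ga.
have A1 : [set z : RR * RR | 0 < al * z.1 /\ be * z.1 + ga * z.2 <= al * z.1]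
    = sector t.
  apply/seteqP; split => z /=; rewrite pmulr_rgt0// => -[z1 h]; split => //.
    by rewrite /t mulrAC ler_pdivlMr// mulrC; lra.
  by move: h; rewrite /t mulrAC ler_pdivlMr// mulrC; lra.
rewrite A1.
set S2 := [set z : RR * RR | _ <= 0 /\ _ ].
have mS2 : measurable S2.
  have -> : S2 = (fun z : RR * RR => al * z.1 + 0 * z.2) @^-1` `]-oo, 0] `&`
      (fun z : RR * RR => (be - al) * z.1 + ga * z.2) @^-1` `]0, +oo[.
    apply/seteqP; split => z /=; rewrite /S2/= !in_itv/= andbT mul0r addr0;
      by move=> -[? ?]; split => //; lra.
  by apply: measurableI; exact: measurable_linear_itv.
have m1 (S : set (RR * RR)) : measurable S ->
    measurable_fun setT (fun z => (\1_S z)%:E : \bar R).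
  by move=> mS; apply/measurable_EFinP; exact: measurable_indic.
have i0 (S : set (RR * RR)) z : (0 <= (\1_S z)%:E :> \bar R)%E by rewrite lee_fin.
have mopp : measurable_fun setT (fun z : RR * RR => (- z.1, - z.2) : RR * RR).
  apply: measurable_fun_pair.
    by apply: (measurableT_comp _ measurable_fst); exact: oppr_measurable.
  by apply: (measurableT_comp _ measurable_snd); exact: oppr_measurable.
have A2 : std_plane (fun z : RR * RR => (\1_S2 z)%:E) =
    std_plane (fun z : RR * RR => (\1_(sector t) z)%:E).
  rewrite -(std_plane_opp (m1 _ mS2) (i0 S2)).
  apply: (std_plane_ae_eq (t := t) (measurableT_comp (m1 _ mS2) mopp)
    (fun _ => i0 S2 _) (m1 _ (measurable_sector t)) (i0 (sector t))).
  move=> x y x0 yx; congr EFin; rewrite !indicE; congr (nat_of_bool _)%:R.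
  have tx : ga * (t * x) = (al - be) * x by rewrite /t; field.
  have {}yx : ga * y != (al - be) * x by rewrite -tx (inj_eq (mulfI ga_neq0)).
  have e : (y <= t * x) = (ga * y <= (al - be) * x) by rewrite -tx ler_pM2l.
  apply/idP/idP; rewrite !inE /S2 /sector/= => -[h1 h2]; split.
  - rewrite lt_def x0/= -(pmulr_rge0 _ al0); lra.
  - by rewrite e; lra.
  - have := mulr_gt0 al0 h1; lra.
  - move: h2; rewrite e le_eqVlt (negbTE yx) /=; lra.
rewrite A2 std_plane_sector/=.
set q := _ + _.
have pi0 : (pi : R) != 0 := lt0r_neq0 (pi_gt0 R).
have qE : q = 2^-1 + atan t / pi.
  by rewrite /q -mulr_natr; move: (pi : R) pi0 => p p0; field.
have [s0 s2] := sin_sector_sqr t.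
rewrite /hurst_map qE ifF; last first.
  apply/negbTE/negP => /eqP q1; have := @atan_ltpi2 R t.
  have -> : atan t = pi / 2; last by rewrite ltxx.
  exact: half_pi pi0 q1.
congr EFin; move: s0 s2; set s := sin _ => s0 s2.
have s2E : s ^+ 2 = be / (2 * al).
  have tE : 1 + t ^+ 2 = (al / ga) ^+ 2.
    rewrite /t !expr_div_n -eqa; field; exact: ga_neq0.
  have alga := divr_ge0 (ltW al0) (ltW ga_gt0).
  rewrite s2 tE sqrtr_sqr (ger0_norm alga) /t; field.
  by rewrite ga_neq0 gt_eqF.
rewrite -s2E (lnXn 2 s0) -[ln s *+ 2]mulr_natl ln4.
by move: (ln 2) ln2 => l l0; field.
Qed.

End change.

(** * Law and moments of two values of a Gaussian process *)

Section pair_law.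
Context d (T : measurableType d) {R : realType} (P : probability T R).
Notation RR := (measurableTypeR R).
Notation N := (@normal_prob R 0 1).
Local Open Scope ereal_scope.

Definition affine_pair (m1 m2 al be ga : R) (z : RR * RR) : RR * RR :=
  (m1 + al * z.1, m2 + (be * z.1 + ga * z.2))%R.

Lemma measurable_affine_pair m1 m2 al be ga :
  measurable_fun setT (affine_pair m1 m2 al be ga).
Proof.
apply: measurable_fun_pair.
  by apply: measurable_funD => //; exact: measurable_funM.
by apply: measurable_funD => //; apply: measurable_funD; exact: measurable_funM.
Qed.

(** An arbitrary number of Gaussian coordinates is replaced by two, which is
    where degenerate covariance matrices and rectangular factors are dealt
    with. *)
Lemma multivariate_normal_pair (mu : set (2.-tuple RR) -> \bar R) :
  multivariate_normal mu ->
  exists m1 m2 al be ga : R, [/\ (0 <= al)%R, (0 <= ga)%R &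
  forall S : set (RR * RR), measurable S ->
    mu [set t | S (tnth t ord0, tnth t ord_max)] =
    std_plane (fun z => (\1_S (affine_pair m1 m2 al be ga z))%:E)].
Proof.
move=> [k [m [M lawE]]].
have [al [be [ga [al0 ga0 H]]]] := std_gaussian_plane (M ord0) (M ord_max).
exists (m ord0 ord0), (m ord_max ord0), al, be, ga; split => // S mS.
have mt : measurable_fun setT
    (fun t : 2.-tuple RR => (tnth t ord0, tnth t ord_max) : RR * RR).
  by apply: measurable_fun_pair; exact: measurable_tnth.
rewrite lawE; last by rewrite -[X in measurable X]setTI; apply: mt.
have mshift : measurable_fun setT
    (fun z : RR * RR => (m ord0 ord0 + z.1, m ord_max ord0 + z.2)%R : RR * RR).
  by apply: measurable_fun_pair; exact: measurable_funD.
have mf : measurable_fun setT (fun z : RR * RR =>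
   (\1_S (m ord0 ord0 + z.1, m ord_max ord0 + z.2)%R)%:E : \bar R).
  apply/measurable_EFinP; apply: measurableT_comp mshift.
  exact: measurable_indic.
rewrite /affine_pair; have /= <- := H _ mf (fun _ => ltac:(by rewrite lee_fin)).
have mlin : measurable_fun setT (fun z : k.-tuple RR =>
   (\sum_(i < k) M ord0 i * tnth z i, \sum_(i < k) M ord_max i * tnth z i)%R : RR * RR).
  by apply: measurable_fun_pair; exact: measurable_linear_form.
set V := pushforward _ _ _.
transitivity (\int[std_gaussian R k]_z (\1_((fun z : k.-tuple RR =>
   (m ord0 ord0 + \sum_(i < k) M ord0 i * tnth z i,
    m ord_max ord0 + \sum_(i < k) M ord_max i * tnth z i)%R : RR * RR) @^-1` S) z)%:E).
  rewrite integral_indic//; last first.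
    by rewrite -[X in measurable X]setTI; exact: (measurableT_comp mshift mlin).
  rewrite setIT /V /pushforward /=; congr (std_gaussian R k _).
  by apply/seteqP; split => z /=; rewrite !tnth_mktuple.
by apply: eq_integral => z _; rewrite !indicE.
Qed.

Lemma gaussian_process_pair (X : R -> {RV P >-> R}) (s t : R) :
  gaussian_process X -> (0 <= s)%R -> (0 <= t)%R ->
  exists m1 m2 al be ga : R, [/\ (0 <= al)%R, (0 <= ga)%R &
  forall S : set (RR * RR), measurable S ->
    P [set w | S (X s w, X t w)] =
    std_plane (fun z => (\1_S (affine_pair m1 m2 al be ga z))%:E)].
Proof.
move=> GX s0 t0; pose u (i : 'I_2) := if i == ord0 then s else t.
have u0 i : (0 <= u i)%R by rewrite /u; case: ifP.
have [m1 [m2 [al [be [ga [al0 ga0 H]]]]]] := multivariate_normal_pair (GX 2%N u u0).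
exists m1, m2, al, be, ga; split => // S mS; rewrite -H// /pushforward.
by congr (P _); apply/seteqP; split => w /=; rewrite !tnth_mktuple.
Qed.

Section transfer.
Variables (U V : {RV P >-> R}) (m1 m2 al be ga : R).
Hypothesis law : forall S : set (RR * RR), measurable S ->
  P [set w | S (U w, V w)] =
  std_plane (fun z => (\1_S (affine_pair m1 m2 al be ga z))%:E).

Lemma ge0_integral_pair_law (f : RR * RR -> \bar R) :
  measurable_fun setT f -> (forall z, 0 <= f z) ->
  \int[P]_w f (U w, V w) = std_plane (fun z => f (affine_pair m1 m2 al be ga z)).
Proof.
move=> mf f0; have ma := measurable_affine_pair m1 m2 al be ga.
have mUV : measurable_fun setT (fun w => (U w, V w) : RR * RR).
  by apply: measurable_fun_pair; [exact: (measurable_funPT U)|exact: (measurable_funPT V)].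
have stdE (g : RR * RR -> \bar R) : measurable_fun setT g -> (forall z, 0 <= g z) ->
    std_plane g = \int[N \x N]_z g z.
  by move=> mg g0; rewrite (@fubini_tonelli1 _ _ _ _ _ N N _ mg).
rewrite (stdE _ (measurableT_comp mf ma) (fun _ => f0 _)).
transitivity (\int[pushforward P (fun w => (U w, V w) : RR * RR)]_z f z).
  by rewrite ge0_integral_pushforward.
transitivity (\int[pushforward (N \x N) (affine_pair m1 m2 al be ga)]_z f z); last first.
  by rewrite ge0_integral_pushforward.
apply: eq_measure_integral => S mS _.
have mSa : measurable (affine_pair m1 m2 al be ga @^-1` S).
  by rewrite -[X in measurable X]setTI; exact: ma.
transitivity (std_plane (fun z => (\1_S (affine_pair m1 m2 al be ga z))%:E)).
  exact: law.
rewrite stdE//; last first.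
  apply/measurable_EFinP; apply: measurableT_comp ma; exact: measurable_indic.
transitivity ((N \x N) (affine_pair m1 m2 al be ga @^-1` S)) => [|//].
rewrite -[X in _ = _ X](setIT (_ @^-1` _)) -integral_indic//.
Qed.

(** Subtracting [m] leaves a variable with the law of the odd function [l];
    its positive and negative parts have equal integrals by central symmetry
    of the plane. *)
Lemma pair_law_mean (g : RR * RR -> RR) (l : RR * RR -> RR) (m : R) :
  measurable_fun setT g -> measurable_fun setT l ->
  (forall z, g (affine_pair m1 m2 al be ga z) = (m + l z)%R) ->
  (forall z, l (- z.1, - z.2)%R = (- l z)%R) ->
  P.-integrable setT (fun w => (g (U w, V w))%:E) ->
  \int[P]_w (g (U w, V w))%:E = m%:E.
Proof.
move=> mg ml gE lN iW.
have iW' : P.-integrable setT (fun w => (g (U w, V w) - m)%:E).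
  apply: (@eq_integrable _ _ _ P _ measurableT
    ((fun w => (g (U w, V w))%:E) \- cst m%:E)) => //.
  by apply: integrableB => //; exact: finite_measure_integrable_cst.
suff W'0 : \int[P]_w (g (U w, V w) - m)%:E = 0.
  transitivity (\int[P]_w ((g (U w, V w) - m)%:E + (cst m%:E w))).
    by apply: eq_integral => w _; rewrite /= -EFinD subrK.
  rewrite integralD//; last exact: finite_measure_integrable_cst.
  by rewrite W'0 add0e integral_cst// -[X in _ * X]/(P setT) probability_setT mule1.
have mh : measurable_fun setT (fun y : RR => (Num.max y 0)%:E : \bar R).
  by apply/measurable_EFinP; exact: measurable_maxr.
have h0 (y : RR) : 0 <= (Num.max y 0)%:E :> \bar R.
  by rewrite lee_fin le_max lexx orbT.
have pos : \int[P]_w (fun w => (g (U w, V w) - m)%:E)^\+ w =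
    std_plane (fun z => (Num.max (l z) 0)%:E).
  have mf : measurable_fun setT
      (fun p : RR * RR => (Num.max (g p - m) 0)%:E : \bar R).
    by apply: (measurableT_comp mh); exact: measurable_funB.
  transitivity (\int[P]_w (Num.max (g (U w, V w) - m) 0)%:E).
    by apply: eq_integral => w _; rewrite funeposE EFin_max.
  apply: etrans (ge0_integral_pair_law mf (fun _ => h0 _)) _.
  by congr std_plane; apply/funext => z; rewrite gE addrAC subrr add0r.
have neg : \int[P]_w (fun w => (g (U w, V w) - m)%:E)^\- w =
    std_plane (fun z => (Num.max (l z) 0)%:E).
  have mf : measurable_fun setT
      (fun p : RR * RR => (Num.max (- (g p - m)) 0)%:E : \bar R).
    by apply: (measurableT_comp mh); apply: measurable_funN; exact: measurable_funB.
  transitivity (\int[P]_w (Num.max (- (g (U w, V w) - m)) 0)%:E).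
    by apply: eq_integral => w _; rewrite funenegE EFin_max EFinN.
  apply: etrans (ge0_integral_pair_law mf (fun _ => h0 _)) _.
  rewrite -[RHS](std_plane_opp (measurableT_comp mh ml) (fun _ => h0 _)).
  by congr std_plane; apply/funext => z /=; rewrite gE addrAC subrr add0r lN.
rewrite [LHS](integralE P) pos neg subee//; rewrite -pos.
apply: integrable_fin_num => //; exact: integrable_funepos.
Qed.

(** The second moment of the standard normal law is left unevaluated: only
    ratios of variances are used, and it is positive and finite as soon as
    one variance is. *)
Lemma pair_law_second_moment (g : RR * RR -> RR) (u v : R) : (0 <= v)%R ->
  measurable_fun setT g ->
  (forall z, g (affine_pair m1 m2 al be ga z) = (u * z.1 + v * z.2)%R) ->
  \int[P]_w ((g (U w, V w)) ^+ 2)%:E =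
  (u ^+ 2 + v ^+ 2)%:E * \int[N]_x (x ^+ 2)%:E.
Proof.
move=> v0 mg gE.
have mq : measurable_fun setT (fun y : RR => (y ^+ 2)%:E : \bar R).
  by apply/measurable_EFinP; exact: measurable_funX.
have q0 (y : RR) : 0 <= (y ^+ 2)%:E :> \bar R by rewrite lee_fin sqr_ge0.
apply: etrans (ge0_integral_pair_law (measurableT_comp mq mg) (fun _ => q0 _)) _.
rewrite (_ : (fun z => _) = fun z => ((u * z.1 + v * z.2) ^+ 2)%:E); last first.
  by apply/funext => z /=; rewrite gE.
rewrite (std_plane_line u v0 mq q0) -ge0_integralZl//.
- apply: eq_integral => x _; rewrite exprMn sqr_sqrtr ?EFinM//.
  by rewrite addr_ge0// sqr_ge0.
- by rewrite lee_fin addr_ge0// sqr_ge0.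
Qed.
End transfer.
End pair_law.

(** * The exponent as a ratio of variances *)

Section second_moments.
Context d (T : measurableType d) {R : realType} (P : probability T R).
Notation RR := (measurableTypeR R).
Notation N := (@normal_prob R 0 1).
Local Open Scope ereal_scope.

Lemma measurable_lt_set d' (T' : measurableType d') (f g : T' -> RR) :
  measurable_fun setT f -> measurable_fun setT g ->
  measurable [set x | f x < g x]%R.
Proof.
move=> mf mg; have -> : [set x | f x < g x]%R = (g \- f)%R @^-1` `]0%R, +oo[.
  by apply/seteqP; split => x /=; rewrite in_itv/= andbT subr_gt0.
rewrite -[X in measurable X]setTI.
have m : measurable_fun setT (g \- f : T' -> RR)%R by exact: measurable_funB.
by apply: m; [exact: measurableT|exact: measurable_itv].
Qed.

Lemma measurable_le_set d' (T' : measurableType d') (f g : T' -> RR) :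
  measurable_fun setT f -> measurable_fun setT g ->
  measurable [set x | f x <= g x]%R.
Proof.
move=> mf mg; have -> : [set x | f x <= g x]%R = ~` [set x | g x < f x]%R.
  by apply/seteqP; split => x /=; rewrite leNgt => /negP.
by apply: measurableC; exact: measurable_lt_set.
Qed.

Lemma Lfun2_of_sqr (Y : T -> R) : measurable_fun setT Y ->
  \int[P]_w ((Y w) ^+ 2)%:E < +oo -> Y \in Lfun P 2%:E.
Proof.
move=> mY Y2; rewrite inE; apply/andP; split; first by rewrite inE.
rewrite inE /= /finite_norm unlock poweR_lty//.
apply: le_lt_trans Y2; apply: ge0_le_integral => //.
- by move=> w _; rewrite poweR_ge0.
- apply/measurable_EFinP.
  apply/(@measurableT_comp _ _ _ _ _ _ (fun x : R => x `^ 2)%R) => //.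
  exact/measurableT_comp.
- by apply/measurable_EFinP; exact: measurable_funX.
- by move=> w _; rewrite /= lee_fin powR_mulrn// real_normK ?num_real.
Qed.

Lemma variance_centered (Y : T -> R) : 'E_P[Y] = 0 ->
  'V_P[Y] = \int[P]_w ((Y w) ^+ 2)%:E.
Proof.
move=> EY; rewrite /variance unlock EY /= unlock.
by apply: eq_integral => w _; congr EFin; rewrite /GRing.mul/= subr0 expr2.
Qed.

Lemma measure_ae_eq (A B : set T) : measurable A -> measurable B ->
  {ae P, forall w, A w <-> B w} -> P A = P B.
Proof.
move=> mA mB AB.
rewrite -[A]setIT -[B]setIT -!integral_indic//.
apply: ae_eq_integral => //; try by apply/measurable_EFinP; exact: measurable_indic.
apply: filterS AB => w ABw _; rewrite /= !indicE; congr (_%:R%:E).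
have -> : (w \in A) = (w \in B) by apply/idP/idP; rewrite !inE => /ABw.
by [].
Qed.

(** Writing the pair [(X tau, X (2 tau))] as [(al x, be x + ga y)], the last
    hypothesis says that the increment [(be - al) x + ga y] has variance [al
    ^ 2], up to the common factor given by the second moment of the standard
    normal law. *)
Lemma hurst_exponent_delayE (X : R -> {RV P >-> R}) (tau : R) :
  gaussian_process X -> {ae P, forall w, X 0%R w = 0%R} -> (0 < tau)%R ->
  'E_P[X tau] = 0 -> 'E_P[X (2 * tau)%R] = 0 ->
  0 < 'V_P[X tau] < +oo -> 0 < 'V_P[X (2 * tau)%R] < +oo ->
  \int[P]_w ((X (2 * tau)%R w - X tau w) ^+ 2)%:E =
    \int[P]_w ((X tau w) ^+ 2)%:E ->
  hurst_exponent_delay X tau =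
  (ln (fine 'V_P[X (2 * tau)%R] / fine 'V_P[X tau]) / ln 2 / 2)%:E.
Proof.
move=> GX X00 tau0 E1 E2 V1 V2 stat.
set U := X tau in E1 V1 stat *; set V := X (2 * tau)%R in E2 V2 stat *.
have [m1 [m2 [al [be [ga [al0 ga0 law]]]]]] :=
  gaussian_process_pair GX (ltW tau0) (mulr_ge0 (ler0n _ 2) (ltW tau0)).
rewrite -/U -/V in law.
have L1 (Y : {RV P >-> R}) : 'E_P[Y] = 0 -> 0 < 'V_P[Y] < +oo ->
    P.-integrable setT (fun w => (Y w)%:E).
  move=> EY /andP[_ VY]; apply/Lfun1_integrable; apply: Lfun_subset12.
    exact: fin_num_measure.
  by apply: Lfun2_of_sqr; [exact: measurable_funPT|rewrite -variance_centered].
have m10 : m1 = 0%R.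
  have ml : measurable_fun setT (fun z : RR * RR => (al * z.1)%R : RR).
    exact: measurable_funM.
  have := pair_law_mean law measurable_fst ml (fun _ => erefl) _ (L1 _ E1 V1).
  have -> : \int[P]_w (U w)%:E = 0 by rewrite -E1 unlock.
  by move=> /(_ (fun z => mulrN al z.1))/(congr1 fine)/= <-.
have m20 : m2 = 0%R.
  have ml : measurable_fun setT (fun z : RR * RR => (be * z.1 + ga * z.2)%R : RR).
    by apply: measurable_funD; exact: measurable_funM.
  have := pair_law_mean law measurable_snd ml (fun _ => erefl) _ (L1 _ E2 V2).
  have -> : \int[P]_w (V w)%:E = 0 by rewrite -E2 unlock.
  have lN (z : RR * RR) : (be * - z.1 + ga * - z.2 = - (be * z.1 + ga * z.2))%R.
    by rewrite !mulrN opprD.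
  by move=> /(_ lN)/(congr1 fine)/= <-.
subst m1 m2.
set kappa := \int[N]_x (x ^+ 2)%:E.
have S1 : 'V_P[U] = (al ^+ 2)%:E * kappa.
  rewrite variance_centered//.
  have := pair_law_second_moment (u := al) law (lexx 0%R) measurable_fst.
  rewrite expr0n/= addr0; apply => z /=.
  by rewrite add0r mul0r addr0.
have S2 : 'V_P[V] = (be ^+ 2 + ga ^+ 2)%:E * kappa.
  rewrite variance_centered//.
  apply: (pair_law_second_moment law ga0 measurable_snd) => z /=.
  by rewrite add0r.
have S3 : 'V_P[U] = ((be - al) ^+ 2 + ga ^+ 2)%:E * kappa.
  rewrite variance_centered// -stat.
  have msub : measurable_fun setT (fun z : RR * RR => (z.2 - z.1)%R : RR).
    exact: measurable_funB.
  apply: (pair_law_second_moment law ga0 msub) => z /=.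
  by rewrite !add0r mulrBl; ring.
have kappa0 : 0 <= kappa by apply: integral_ge0 => x _; rewrite lee_fin sqr_ge0.
have [al_gt0 [k kE k0]] : (0 < al)%R /\ exists2 k : R, kappa = k%:E & (0 < k)%R.
  have al_neq0 : al != 0%R.
    by apply/eqP => al_eq0; move: V1; rewrite S1 al_eq0 expr0n/= mul0e ltxx.
  have al_gt0 : (0 < al)%R by rewrite lt_def al_neq0.
  split => //; move: V1; rewrite S1 => /andP[V1pos V1fin].
  have kE : kappa = (fine kappa)%:E.
    rewrite fineK// ge0_fin_numE// ltey; apply/negP => /eqP ky.
    by move: V1fin; rewrite ky gt0_muley ?lte_fin ?exprn_gt0// ltxx.
  exists (fine kappa) => //; move: V1pos.
  by rewrite kE -EFinM lte_fin pmulr_rgt0 ?exprn_gt0.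
have eqa : ((be - al) ^+ 2 + ga ^+ 2 = al ^+ 2)%R.
  move: S3; rewrite S1 kE -!EFinM => -[] /(mulIf _) -> //.
  by rewrite gt_eqF.
have pos : (0 < be ^+ 2 + ga ^+ 2)%R.
  move: V2; rewrite S2 kE -EFinM => /andP[+ _].
  by rewrite lte_fin pmulr_lgt0.
have -> : (fine 'V_P[V] / fine 'V_P[U] = (be ^+ 2 + ga ^+ 2) / al ^+ 2)%R.
  rewrite S1 S2 kE -!EFinM/=; field.
  by rewrite !gt_eqF.
rewrite -(hurst_map_triangular al_gt0 ga0 eqa pos).
have [mt1 mt21 mt22] : [/\ measurable_fun setT (fun t : RR * (RR * RR) => t.1),
    measurable_fun setT (fun t : RR * (RR * RR) => t.2.1) &
    measurable_fun setT (fun t : RR * (RR * RR) => t.2.2)].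
  split; [exact: measurable_fst|exact: (measurableT_comp measurable_fst measurable_snd)|
    exact: (measurableT_comp measurable_snd measurable_snd)].
have mUV : measurable_fun setT (fun w => (X 0%R w, (U w, V w)) : RR * (RR * RR)).
  by apply: measurable_fun_pair; [exact: (measurable_funPT (X 0%R))|
    apply: measurable_fun_pair; [exact: (measurable_funPT U)|exact: (measurable_funPT V)]].
have transfer (A : set (RR * (RR * RR))) (S : set (RR * RR)) :
    measurable A -> measurable S -> (forall z, A (0%R, z) <-> S z) ->
    P [set w | A (X 0%R w, (U w, V w))] =
    std_plane (fun z => (\1_S (affine_pair 0 0 al be ga z))%:E).
  move=> mA mS AS; rewrite -law//; apply: measure_ae_eq.
  - by rewrite -[X in measurable X]setTI; exact: mUV.
  - rewrite -[X in measurable X]setTI.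
    have m2 := measurableT_comp measurable_snd mUV; exact: m2.
  - by apply: filterS X00 => w /= ->; exact: AS.
rewrite /hurst_exponent_delay /change_probability -/U -/V.
congr (hurst_map (fine _ + fine _)).
- apply: etrans (transfer [set t | t.1 < t.2.1 /\ t.2.2 <= t.2.1]%R
    [set p | 0 < p.1 /\ p.2 <= p.1]%R _ _ (fun=> iff_refl _)) _.
  + by apply: measurableI; [exact: measurable_lt_set|exact: measurable_le_set].
  + by apply: measurableI; [exact: measurable_lt_set|exact: measurable_le_set].
  + by congr std_plane; apply/funext => z; rewrite !indicE /affine_pair !add0r.
- apply: etrans (transfer [set t | t.2.1 <= t.1 /\ t.2.1 < t.2.2]%R
    [set p | p.1 <= 0 /\ p.1 < p.2]%R _ _ (fun=> iff_refl _)) _.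
  + by apply: measurableI; [exact: measurable_le_set|exact: measurable_lt_set].
  + by apply: measurableI; [exact: measurable_le_set|exact: measurable_lt_set].
  + by congr std_plane; apply/funext => z; rewrite !indicE /affine_pair !add0r.
Qed.


End second_moments.

(** * Dyadic growth of a sequence with given second differences *)

Section dyadic.
Context {R : realType}.

Lemma geometric_domination (x y A B : R) (j0 : nat) : 0 < x -> x < y ->
  (forall j, (j0 <= j)%N -> A * y ^+ j <= B * x ^+ j) -> A <= 0.
Proof.
move=> x0 xy AB; have y0 := lt_trans x0 xy.
have z1 : `|x / y| < 1 by rewrite ger0_norm ?divr_ge0 ?ltW// ltr_pdivrMr ?mul1r.
have cB : (fun j => B * (x / y) ^+ j) @ \oo --> (0 : R).
  by rewrite -[X in _ --> X](mulr0 B); apply: cvgM; [exact: cvg_cst|exact: cvg_expr].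
apply: (cvgr_to_ge cB).
near=> j; rewrite expr_div_n mulrA ler_pdivlMr ?exprn_gt0//; apply: AB.
by near: j; exact: nbhs_infty_ge.
Unshelve. all: by end_near. Qed.

Lemma increment_ge (f : nat -> R) (c : R) (n p : nat) :
  (forall k, (n <= k < n + p)%N -> c <= f k.+1 - f k) ->
  f n + p%:R * c <= f (n + p)%N.
Proof.
elim: p => [|p IH] fc; first by rewrite mul0r addr0 addn0.
have := fc (n + p)%N; rewrite leq_addr addnS ltnS leqnn => /(_ isT) h1.
rewrite -natr1 mulrDl mul1r.
have : f n + p%:R * c <= f (n + p)%N.
  apply: IH => k /andP[k1 k2]; apply: fc; rewrite k1/= addnS ltnS ltnW//.
lra.
Qed.

Lemma increment_le (f : nat -> R) (c : R) (n p : nat) :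
  (forall k, (n <= k < n + p)%N -> f k.+1 - f k <= c) ->
  f (n + p)%N <= f n + p%:R * c.
Proof.
move=> fc; have := @increment_ge (fun k => - f k) (- c) n p.
rewrite mulrN -opprD lerN2; apply => k /fc; lra.
Qed.

(** A series dominated by a geometric series of ratio greater than one is
    dominated by its last term. *)
Lemma geometric_recursion (u : nat -> R) (M rho : R) (j0 : nat) :
  0 <= M -> 1 < rho ->
  (forall j, (j0 <= j)%N -> u j.+1 <= u j + M * rho ^+ j) ->
  exists2 K, 0 <= K & forall j, (j0 <= j)%N -> u j <= K * rho ^+ j.
Proof.
move=> M0 rho1 step; have rho0 : 0 < rho by lra.
have K0 : 0 <= `|u j0| + M / (rho - 1).
  by rewrite addr_ge0// divr_ge0// subr_ge0 ltW.
exists (`|u j0| + M / (rho - 1)) => // j /subnKC <-.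
elim: (j - j0)%N => [|i IH].
  rewrite addn0; apply: (le_trans (ler_norm _)).
  apply: (@le_trans _ _ (`|u j0| + M / (rho - 1))).
    by rewrite lerDl divr_ge0// subr_ge0 ltW.
  by rewrite ler_peMr// exprn_ege1// ltW.
rewrite addnS; apply: le_trans (step _ (leq_addr _ _)) _.
apply: (le_trans (lerD IH (lexx _))).
rewrite -mulrDl exprS mulrA ler_pM2r ?exprn_gt0//.
set x := M / _; have Mx : M = x * (rho - 1) by rewrite divfK// subr_eq0 gt_eqF.
rewrite [X in _ + X <= _]Mx -subr_ge0.
have -> : (`|u j0| + x) * rho - (`|u j0| + x + x * (rho - 1)) = `|u j0| * (rho - 1).
  by ring.
by rewrite mulr_ge0// subr_ge0 ltW.
Qed.

Lemma double_pow2 (j : nat) : (2 ^ j.+1 = 2 ^ j + 2 ^ j)%N.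
Proof. by rewrite expnS mul2n addnn. Qed.

Variables (v C : nat -> R) (e : R).
Hypothesis v_diff2 : forall n, (v n.+2 - v n.+1) - (v n.+1 - v n) = 2 * C n.+1.
Hypothesis e_range : -1 <= e < 0.

Let s : R := 2 `^ (e + 1).
Let D n := v n.+1 - v n.

Let s1 : 1 <= s.
Proof.
have e0 : 0 <= e + 1 by case/andP: e_range; lra.
by apply: le_trans (ler_powR _ e0); rewrite ?powRr0 ?ler1n.
Qed.

Let powR_pow2 j : (2 ^ j)%:R `^ e * 2 ^+ j = s ^+ j.
Proof.
rewrite natrX /s -(powR_mulrn j (ler0n R 2)) -(powR_mulrn j (powR_ge0 2 (e + 1))).
rewrite -!powRrM -powRD; last by rewrite (pnatr_eq0 R 2) implybT.
congr powR; ring.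
Qed.

Let powR_le (m n : nat) : (0 < m)%N -> (m <= n)%N -> n%:R `^ e <= m%:R `^ e :> R.
Proof.
move=> m0 mn; have n0 := leq_trans m0 mn.
have -> : e = - - e by rewrite opprK.
rewrite (powRN _ (- e)) (powRN _ (- e)) lef_pV2 ?posrE ?powR_gt0 ?ltr0n//.
by rewrite ge0_ler_powR ?nnegrE ?ler0n ?ler_nat//; case/andP: e_range; lra.
Qed.

(** The increments of [D n = v n.+1 - v n] over a dyadic block add up to a
    multiple of [s ^ j], with [s = 2 ^ (e + 1) >= 1].  So [D] eventually
    becomes nonnegative along the powers of two, after which [D (2 ^ j)]
    alone is at least that multiple; a block of [2 ^ j] such increments moves
    [v] by a multiple of [(2 s) ^ j]. *)
Lemma dyadic_increment_ge (a : R) (n0 : nat) : 0 < a ->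
  (forall n, (n0 <= n)%N -> a * n%:R `^ e <= C n) ->
  exists j1 : nat, forall j, (j1 <= j)%N ->
    v (2 ^ j)%N + a * (2 * s) ^+ j <= v (2 ^ j.+1)%N.
Proof.
move=> a0 aC.
have Dmono n : (n0 <= n)%N -> 0 <= D n.+1 - D n.
  move=> n0n; rewrite /D v_diff2 mulr_ge0//.
  by apply: le_trans (aC _ (leqW n0n)); rewrite mulr_ge0 ?powR_ge0 ?ltW.
have j2n j : (n0 <= j)%N -> (n0 <= 2 ^ j)%N.
  by move=> h; rewrite (leq_trans h)// ltnW// ltn_expl.
have Dstep j : (n0 <= j)%N -> D (2 ^ j)%N + a * s ^+ j.+1 <= D (2 ^ j.+1)%N.
  move=> /j2n n0j; rewrite double_pow2.
  have := @increment_ge D (2 * (a * (2 ^ j.+1)%:R `^ e)) (2 ^ j) (2 ^ j).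
  rewrite -powR_pow2 exprS; set P := powR _ _ => H.
  have -> : a * (P * (2 * 2 ^+ j)) = (2 ^ j)%:R * (2 * (a * P)).
    by rewrite natrX; ring.
  apply: H => k /andP[k1 k2]; rewrite /D v_diff2 ler_pM2l//.
  apply: le_trans (aC _ _); last by rewrite (leq_trans n0j)// ltnW.
  rewrite ler_pM2l// /P; apply: powR_le => //.
  by rewrite double_pow2.
have Dlin k : D (2 ^ n0)%N + k%:R * a <= D (2 ^ (n0 + k))%N.
  apply: (@increment_ge (fun j => D (2 ^ j)%N)) => j /andP[j1 _].
  rewrite lerBrDl; apply: le_trans (Dstep _ j1); rewrite lerD2l.
  by rewrite ler_peMr ?exprn_ege1 ?(ltW a0).
have [k Dk] : exists k : nat, 0 <= D (2 ^ (n0 + k))%N.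
  have [k hk] : exists k : nat, - D (2 ^ n0)%N / a < k%:R.
    by exists (Num.truncn (- D (2 ^ n0)%N / a)).+1; exact: truncnS_gt.
  exists k; apply: le_trans (Dlin k).
  by move: hk; rewrite ltr_pdivrMr// => hk; lra.
have Dpos i : 0 <= D (2 ^ (n0 + k + i))%N.
  elim: i => [|i IH]; first by rewrite addn0.
  rewrite addnS; apply: le_trans (Dstep _ _); last by rewrite -addnA leq_addr.
  by rewrite addr_ge0// mulr_ge0 ?(ltW a0)// exprn_ge0// (le_trans ler01).
exists (n0 + k).+1 => -[//|j]; rewrite ltnS => kj.
have n0j : (n0 <= j)%N by rewrite (leq_trans (leq_addr _ _) kj).
have Dj : a * s ^+ j.+1 <= D (2 ^ j.+1)%N.
  apply: le_trans (Dstep _ n0j); rewrite lerDr.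
  by rewrite -(subnKC kj); exact: Dpos.
rewrite (double_pow2 j.+1) exprMn.
apply: le_trans (@increment_ge v (a * s ^+ j.+1) _ _ _).
  by rewrite lerD2l natrX mulrCA.
move=> m /andP[m1 _]; apply: le_trans Dj _.
rewrite -(subnKC m1) -/(D _).
have := @increment_ge D 0 (2 ^ j.+1) (m - 2 ^ j.+1); rewrite mulr0 addr0; apply.
move=> i /andP[i1 _]; apply: Dmono; apply: leq_trans i1.
by apply: j2n; exact: leqW.
Qed.

(** The rate is any [r > s] rather than [s] itself: for [e = -1], where [s =
    1], the values of [D] along the powers of two grow linearly in [j]. *)
Lemma dyadic_le (B r : R) (n0 : nat) : s < r ->
  (forall n, (n0 <= n)%N -> 0 <= C n <= B * n%:R `^ e) ->
  exists K : R, forall j, (n0 <= j)%N -> v (2 ^ j)%N <= K * (2 * r) ^+ j.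
Proof.
move=> sr CB; have r1 : 1 < r := le_lt_trans s1 sr.
have r0 : 0 < r by lra.
have B0 : 0 <= B.
  have /andP[h1 h2] := CB _ (leqnSn n0); move: (le_trans h1 h2).
  by rewrite pmulr_lge0// powR_gt0.
have j2n j : (n0 <= j)%N -> (n0 <= 2 ^ j)%N.
  by move=> h; rewrite (leq_trans h)// ltnW// ltn_expl.
have [|j n0j|K K0 DK] := @geometric_recursion (fun j => D (2 ^ j)%N) (2 * B) r n0 _ r1.
- by rewrite mulr_ge0.
- apply: (@le_trans _ _ (D (2 ^ j)%N + 2 * B * s ^+ j)); last first.
    by rewrite lerD2l ler_wpM2l ?mulr_ge0// lerXn2r ?nnegrE ?(ltW sr)// ltW//
      (lt_le_trans ltr01).
  rewrite double_pow2 -powR_pow2; set P := powR _ _.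
  have -> : 2 * B * (P * 2 ^+ j) = (2 ^ j)%:R * (2 * (B * P)).
    by rewrite natrX; ring.
  apply: increment_le => k /andP[k1 k2]; rewrite /D v_diff2 ler_pM2l//.
  have n0k : (n0 <= k.+1)%N by rewrite (leq_trans (j2n _ n0j))// ltnW.
  have /andP[_] := CB _ n0k; move=> /le_trans; apply.
  by rewrite ler_wpM2l// /P; apply: powR_le; rewrite ?expn_gt0// ltnW.
have [|| |K' _ vK] := @geometric_recursion (fun j => v (2 ^ j)%N) (K * r) (2 * r) n0.
- by rewrite mulr_ge0// ltW.
- by lra.
- move=> j n0j.
  apply: (@le_trans _ _ (v (2 ^ j)%N + (2 ^ j)%:R * D (2 ^ j.+1)%N)).
    rewrite double_pow2; apply: increment_le => k /andP[k1 k2].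
    rewrite -/(D _) -(subnKC (ltnW k2)).
    have := @increment_ge D 0 k (2 ^ j + 2 ^ j - k); rewrite mulr0 addr0; apply.
    move=> i /andP[i1 _]; rewrite /D v_diff2 mulr_ge0//.
    have n0i : (n0 <= i.+1)%N.
      by rewrite (leq_trans (j2n _ n0j))// (leq_trans k1)// (leq_trans i1).
    by have /andP[] := CB _ n0i.
  rewrite lerD2l exprMn -natrX.
  have -> : K * r * ((2 ^ j)%:R * r ^+ j) = (2 ^ j)%:R * (K * r ^+ j.+1).
    by rewrite exprS; ring.
  by rewrite ler_wpM2l ?ler0n//; apply: DK; exact: leqW.
by exists K'.
Qed.

End dyadic.

Section dyadic_ratio.
Context {R : realType}.
Variables (v C : nat -> R) (H L : R).
Hypothesis v_diff2 : forall n, (v n.+2 - v n.+1) - (v n.+1 - v n) = 2 * C n.+1.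
Hypothesis v_gt0 : forall n, (0 < n)%N -> 0 < v n.
Hypothesis H_range : 2^-1 <= H < 1.
Hypothesis L_neq0 : L != 0.
Hypothesis C_lim : C n / n%:R `^ (2 * H - 2) @[n --> \oo] --> L.

Let e_range : -1 <= 2 * H - 2 < 0.
Proof. by case/andP: H_range => h1 h2; apply/andP; split; lra. Qed.

Let two_s : 2 * 2 `^ (2 * H - 2 + 1) = 2 `^ (2 * H) :> R.
Proof.
have -> : 2 * H = 1 + (2 * H - 2 + 1) by ring.
rewrite [RHS]powRD ?powRr1//; last by rewrite (pnatr_eq0 R 2) implybT.
by congr (_ * _ `^ _); ring.
Qed.

Let C_bounds a b : a < L -> L < b -> exists2 n0 : nat, (0 < n0)%N &
  forall n, (n0 <= n)%N -> a * n%:R `^ (2 * H - 2) <= C n <= b * n%:R `^ (2 * H - 2).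
Proof.
move=> aL Lb.
have [n1 _ h1] := cvgr_ge _ C_lim _ aL.
have [n2 _ h2] := cvgr_le _ C_lim _ Lb.
exists (maxn 1 (maxn n1 n2)) => [|n]; first by rewrite leq_max.
rewrite !geq_max => /and3P[n0 n1n n2n].
have P0 : 0 < (n%:R : R) `^ (2 * H - 2) by rewrite powR_gt0// ltr0n.
by have := h1 _ n1n; have := h2 _ n2n; rewrite /= ler_pdivlMr// ler_pdivrMr// => -> ->.
Qed.

(** With a negative limit, [- v] would satisfy the lower bound on dyadic
    increments and tend to infinity, contradicting [v > 0]. *)
Lemma limit_correlation_gt0 : 0 < L.
Proof.
rewrite lt_neqAle eq_sym L_neq0 leNgt/=; apply/negP => L0.
have [a La a0] : exists2 a, L < - a & 0 < a by exists (- L / 2); lra.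
have L1 : L - 1 < L by lra.
have [n0 _ Cb] := C_bounds L1 La.
have vN n : (- v n.+2 - - v n.+1) - (- v n.+1 - - v n) = 2 * - C n.+1.
  by rewrite mulrN -v_diff2; ring.
have [|j1 hj] := @dyadic_increment_ge R (fun n => - v n) (fun n => - C n) _ vN
  e_range a n0 a0.
  by move=> n /Cb /andP[_]; lra.
have lin i : - v (2 ^ j1)%N + i%:R * a <= - v (2 ^ (j1 + i))%N.
  apply: (@increment_ge _ (fun j => - v (2 ^ j)%N)) => j /andP[jj _].
  rewrite lerBrDl; apply: le_trans (hj _ jj); rewrite lerD2l ler_peMr ?(ltW a0)//.
  rewrite two_s exprn_ege1// -[leLHS](powRr0 2).
  by apply: ler_powR; [rewrite ler1n|case/andP: H_range => *; lra].
pose i := (Num.truncn (v (2 ^ j1)%N / a)).+1.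
have hi : v (2 ^ j1)%N / a < i%:R by exact: truncnS_gt.
have := lin i; have := v_gt0 (expn_gt0 2 (j1 + i)).
by move: hi; rewrite ltr_pdivrMr//; lra.
Qed.

(** A ratio eventually at most [q] bounds [v (2 ^ j)] by a multiple of [q ^
    j], while it is at least a multiple of [(2 ^ (2H)) ^ j]. *)
Lemma dyadic_ratio_le_bound (q : R) (j0 : nat) : 0 < q ->
  (forall j, (j0 <= j)%N -> v (2 ^ j.+1)%N <= q * v (2 ^ j)%N) ->
  2 `^ (2 * H) <= q.
Proof.
move=> q0 hq; rewrite leNgt; apply/negP => qQ.
have L0 := limit_correlation_gt0.
have [a0 aL] : 0 < L / 2 /\ L / 2 < L by split; lra.
have L1 : L < L + 1 by lra.
have [n0 _ Cb] := C_bounds aL L1.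
have [|j1 hj] := @dyadic_increment_ge R v C _ v_diff2 e_range _ n0 a0.
  by move=> n /Cb /andP[].
have vq i : v (2 ^ (j0 + i))%N <= v (2 ^ j0)%N * q ^+ i.
  elim: i => [|i IH]; first by rewrite addn0 mulr1.
  rewrite addnS; apply: le_trans (hq _ (leq_addr _ _)) _.
  by rewrite exprS mulrCA ler_pM2l.
have vq' j : (j0 <= j)%N -> v (2 ^ j)%N <= v (2 ^ j0)%N / q ^+ j0 * q ^+ j.
  move=> j0j; have := vq (j - j0)%N; rewrite subnKC// => h.
  by rewrite -[in leRHS](subnKC j0j) exprD mulrA divfK// expf_neq0// gt_eqF.
suff : L / 2 <= 0 by lra.
apply: (@geometric_domination _ q (2 `^ (2 * H)) (L / 2)
  (v (2 ^ j0)%N / q ^+ j0 * q) (maxn j0 j1) q0 qQ) => j.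
rewrite geq_max => /andP[jj0 jj1].
have := hj _ jj1; rewrite two_s => h.
rewrite -[leRHS]mulrA -exprS; apply: le_trans (vq' _ (leqW jj0)).
by apply: le_trans h; rewrite lerDr ltW// v_gt0// expn_gt0.
Qed.

(** A ratio eventually at least [q > 2 ^ (2H)] would make [v (2 ^ j)] outgrow
    [(2 r) ^ j] for some [r] with [2 r < q], against the upper bound. *)
Lemma dyadic_ratio_ge_bound (q : R) (j0 : nat) :
  (forall j, (j0 <= j)%N -> q * v (2 ^ j)%N <= v (2 ^ j.+1)%N) ->
  q <= 2 `^ (2 * H).
Proof.
move=> hq; rewrite leNgt; apply/negP => qQ.
have L0 := limit_correlation_gt0.
have q0 : 0 < q by apply: le_lt_trans qQ; rewrite powR_ge0.
have L1 : L < L + 1 by lra.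
have [n0 _ Cb] := C_bounds L0 L1.
have [r [sr rq r0]] : exists r, [/\ 2 `^ (2 * H - 2 + 1) < r, 2 * r < q & 0 < r].
  (* The midpoint of [s] and [q / 2]. *)
  exists ((2 `^ (2 * H - 2 + 1) + q / 2) / 2); move: qQ; rewrite -two_s.
  by have := powR_ge0 (2 : R) (2 * H - 2 + 1); split; lra.
have [|K hK] := @dyadic_le R v C _ v_diff2 e_range (L + 1) r n0 sr.
  by move=> n /Cb /andP[h1 h2]; rewrite h2 andbT; move: h1; rewrite mul0r.
have vq i : v (2 ^ j0)%N * q ^+ i <= v (2 ^ (j0 + i))%N.
  elim: i => [|i IH]; first by rewrite addn0 mulr1.
  rewrite addnS; apply: le_trans (hq _ (leq_addr _ _)).
  by rewrite exprS mulrCA ler_pM2l.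
have vq' j : (j0 <= j)%N -> v (2 ^ j0)%N / q ^+ j0 * q ^+ j <= v (2 ^ j)%N.
  move=> j0j; have := vq (j - j0)%N; rewrite subnKC// => h.
  by rewrite -[in leLHS](subnKC j0j) exprD mulrA divfK// expf_neq0// gt_eqF.
have : v (2 ^ j0)%N / q ^+ j0 <= 0.
  apply: (@geometric_domination _ (2 * r) q _ K (maxn j0 n0)) => //.
    by rewrite mulr_gt0.
  move=> j; rewrite geq_max => /andP[jj0 jn0].
  by apply: le_trans (hK _ jn0); exact: vq'.
by rewrite leNgt divr_gt0// ?exprn_gt0// v_gt0// expn_gt0.
Qed.

End dyadic_ratio.

(** * Stationary increments and the growth of the variance *)

Section stationary_kernel.
Context {R : realType}.
Variables (B : nat -> nat -> R) (Gam : nat -> R).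
Hypothesis B_sym : forall i j, B i j = B j i.
Hypothesis B0 : forall j, B 0%N j = 0.
Let u i j := B i.+1 j.+1 - B i.+1 j - B i j.+1 + B i j.
Hypothesis u_stat : forall i k, u (i + k)%N i = Gam k.

Let u_shift a i j : u (a + i)%N (a + j)%N = u i j.
Proof.
have u_sym m n : u m n = u n m.
  by rewrite /u !(B_sym m) !(B_sym m.+1); ring.
have key m n : (n <= m)%N -> u m n = Gam (m - n).
  by move=> h; rewrite -{1}(subnKC h).
by have [h|/ltnW h] := leqP j i; [|rewrite u_sym [RHS]u_sym];
  rewrite !key ?leq_add2l// subnDl.
Qed.

(** The left-hand side is the covariance of the increments over the blocks
    [a, a + p] and [a, a + q], a double sum of covariances of unit
    increments, each of which depends on the lag only. *)
Lemma kernel_shift a p q :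
  B (a + p)%N (a + q)%N - B (a + p)%N a - B a (a + q)%N + B a a = B p q.
Proof.
(* The covariance of a unit increment with a block of [q] unit increments. *)
pose Z b m n := B (b + m.+1)%N (b + n)%N - B (b + m)%N (b + n)%N
                - B (b + m.+1)%N b + B (b + m)%N b.
have ZE m n : Z a m n = Z 0%N m n.
  elim: n => [|n IH]; first by rewrite /Z !addn0; ring.
  have Zstep b : Z b m n.+1 - Z b m n = u (b + m)%N (b + n)%N.
    by rewrite /Z /u !addnS; ring.
  by apply/eqP; rewrite -subr_eq0 -(subrK (Z a m n) (Z a m n.+1)) Zstep IH u_shift
    -(u_shift 0) -Zstep; apply/eqP; ring.
elim: p => [|p IH]; first by rewrite addn0 B0; ring.
have := ZE p q; rewrite /Z !add0n => h.
have B0' m : B m 0%N = 0 by rewrite B_sym.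
rewrite -[RHS](subrK (B p q)); move: h; rewrite !B0' !subr0 addr0 => <-.
by rewrite -[in RHS]IH; ring.
Qed.

Lemma kernel_double n :
  B (n + n)%N (n + n)%N - B (n + n)%N n *+ 2 + B n n = B n n.
Proof. by rewrite -[RHS](kernel_shift n n n) (B_sym n (n + n)%N); ring. Qed.

(** By [kernel_shift] at [a = 1], the increment of the variance at [n] is [2
    * B n.+1 1] minus a constant, and the increments of [B _ 1] are the
    values of [Gam]. *)
Lemma kernel_diff2 n :
  (B n.+2 n.+2 - B n.+1 n.+1) - (B n.+1 n.+1 - B n n) = 2 * Gam n.+1.
Proof.
have B0' m : B m 0%N = 0 by rewrite B_sym.
have h m : B m.+1 m.+1 - B m m = 2 * B m.+1 1%N - B 1%N 1%N.
  by rewrite -[B m m](kernel_shift 1) !add1n (B_sym 1%N); ring.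
by rewrite !h -(u_stat 0 n.+1) /u !add0n !B0'; ring.
Qed.

End stationary_kernel.

Section process.
Context d (T : measurableType d) (R : realType) (P : probability T R).
Variable X : R -> {RV P >-> R}.
Hypothesis X_gaussian : gaussian_process X.
Hypothesis X_0 : {ae P, forall w, X 0 w = 0}.
Hypothesis X_centered : forall t : R, 0 <= t -> ('E_P[X t] = 0)%E.
Hypothesis X_cov : forall tau s t : R, 0 <= tau -> 0 <= s -> 0 <= t ->
  covariance P (X (s + tau + 1) \- X (s + tau)) (X (s + 1) \- X s) =
  covariance P (X (t + tau + 1) \- X (t + tau)) (X (t + 1) \- X t).
Hypothesis X_var : forall t : R, 0 < t -> (0 < 'V_P[X t] < +oo)%E.

Let X_Lfun2 t : 0 <= t -> (X t : T -> R) \in Lfun P 2%:E.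
Proof.
rewrite le_eqVlt => /predU1P[<-|t0].
  apply: Lfun2_of_sqr; first exact: measurable_funPT.
  rewrite (_ : integral _ _ _ = 0%E)//.
  transitivity (\int[P]_w cst 0%E w)%E; last by rewrite integral0.
  apply: ae_eq_integral => //.
    by apply/measurable_EFinP; apply: measurable_funX; exact: measurable_funPT.
  by apply: filterS X_0 => w Xw _ /=; rewrite Xw expr0n.
apply: Lfun2_of_sqr; first exact: measurable_funPT.
rewrite -variance_centered; first by have /andP[] := X_var t0.
by apply: X_centered; exact: ltW.
Qed.

Let cov (s t : R) : R := fine (covariance P (X s) (X t)).

Lemma covariance_Lfun2_fin_num (U V : T -> R) : U \in Lfun P 2%:E ->
  V \in Lfun P 2%:E -> covariance P U V \is a fin_num.
Proof.
move=> U2 V2; have PT : P setT \is a fin_num := fin_num_measure P _ measurableT.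
by apply: covariance_fin_num; [exact: Lfun_subset12|exact: Lfun_subset12|
  exact: Lfun2_mul_Lfun1].
Qed.

Let cov_increment (a b c e : R) : 0 <= a -> 0 <= b -> 0 <= c -> 0 <= e ->
  fine (covariance P (X a \- X b) (X c \- X e)) =
  cov a c - cov b c - cov a e + cov b e.
Proof.
move=> a0 b0 c0 e0.
have two1 : (1 <= 2%:E :> \bar R)%E by rewrite lee_fin ler1n.
have fin := covariance_Lfun2_fin_num.
have D : X a \- X b \in Lfun P 2%:E.
  exact: (rpredB (X_Lfun2 a0) (X_Lfun2 b0)).
rewrite covarianceBr// ?covarianceBl ?X_Lfun2//.
rewrite fineB ?fin_numB ?fin ?X_Lfun2// !fineB ?fin ?X_Lfun2//.
by rewrite /cov; ring.
Qed.

Let cov0 t : cov 0 t = 0.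
Proof.
rewrite /cov unlock X_centered// unlock (_ : integral _ _ _ = 0%E)//.
transitivity (\int[P]_w cst 0%E w)%E; last by rewrite integral0.
apply: ae_eq_integral => //.
  apply/measurable_EFinP; apply: measurable_funM; apply: measurable_funB => //;
  exact: measurable_funPT.
by apply: filterS X_0 => w Xw _; rewrite /= /GRing.mul/= Xw subrr mul0r.
Qed.

Let B (i j : nat) : R := cov i%:R j%:R.
Let Gam (k : nat) : R := increment_autocorrelation X k%:R * fine 'V_P[X 1].

Let B_sym i j : B i j = B j i. Proof. by rewrite /B /cov covarianceC. Qed.
Let B0 j : B 0%N j = 0. Proof. exact: cov0. Qed.

Let B_stat i k :
  B (i + k).+1 i.+1 - B (i + k).+1 i - B (i + k)%N i.+1 + B (i + k)%N i = Gam k.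
Proof.
have V1 : fine 'V_P[X 1] != 0.
  have /andP[V0 Vfin] := X_var ltr01.
  by rewrite gt_eqF// fine_gt0// V0.
rewrite /Gam /increment_autocorrelation divfK//.
have n1 (m : nat) : m%:R + 1 = m.+1%:R :> R by rewrite natr1.
have := X_cov (ler0n R k) (ler0n R i) (lexx 0).
rewrite !add0r -natrD !n1 => /(congr1 fine).
rewrite !cov_increment ?ler0n ?ler01// => h.
have cov0' t : cov t 0 = 0 by rewrite /cov covarianceC; exact: cov0.
rewrite covarianceBl ?X_Lfun2 ?ler0n ?ler01//.
rewrite fineB ?covariance_Lfun2_fin_num ?X_Lfun2 ?ler0n ?ler01//.
move: h; rewrite /B !cov0' subr0 addr0 => <-; ring.
Qed.

Let v (n : nat) := B n n.

Let v_gt0 n : (0 < n)%N -> 0 < v n.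
Proof.
move=> n0; have nR : 0 < n%:R :> R by rewrite ltr0n.
have /andP[V0 Vfin] := X_var nR.
by rewrite /v /B /cov fine_gt0// V0 Vfin.
Qed.

Lemma hurst_exponent_delay_nat (n : nat) : (0 < n)%N ->
  hurst_exponent_delay X n%:R = (ln (v (n + n)%N / v n) / ln 2 / 2)%:E.
Proof.
move=> n0; have nR : 0 < n%:R :> R by rewrite ltr0n.
have E2n : 2 * n%:R = (n + n)%:R :> R by rewrite natrD mulr_natl mulr2n.
have L2 (m : nat) : (X m%:R : T -> R) \in Lfun P 2%:E by apply: X_Lfun2.
have L1 (m : nat) : (X m%:R : T -> R) \in Lfun P 1.
  by apply: Lfun_subset12 => //; exact: fin_num_measure.
have Ex (m : nat) : ('E_P[X m%:R] = 0)%E by apply: X_centered.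
have nn0 : 0 < (n + n)%:R :> R by rewrite ltr0n addn_gt0 n0.
rewrite hurst_exponent_delayE ?E2n ?X_var//.
have ED : ('E_P[X (n + n)%:R \- X n%:R] = 0)%E by rewrite expectationB// !Ex sube0.
rewrite -(variance_centered ED) -(variance_centered (Ex n)) varianceB//.
rewrite -(fineK (variance_fin_num (L2 n))) -(fineK (variance_fin_num (L2 (n + n)%N))).
rewrite -(fineK (covariance_Lfun2_fin_num (L2 (n + n)%N) (L2 n))).
rewrite -EFinM -EFinN -!EFinD; congr EFin.
have := kernel_double B_sym B0 B_stat n; rewrite /B /cov /variance => h.
rewrite -[RHS]h; ring.
Qed.



Variable H : R.
Hypothesis H_range : 2^-1 <= H < 1.
Hypothesis c_lim : exists2 L : R, L != 0 &
  increment_autocorrelation X tau / tau `^ (2 * H - 2) @[tau --> +oo] --> L.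

Let Gam_lim : exists2 L : R, L != 0 & Gam n / n%:R `^ (2 * H - 2) @[n --> \oo] --> L.
Proof.
have [L L0 cL] := c_lim.
have V1 : fine 'V_P[X 1] != 0.
  have /andP[V0 Vfin] := X_var ltr01.
  by rewrite gt_eqF// fine_gt0// V0.
exists (L * fine 'V_P[X 1]); first by rewrite mulf_neq0.
have cn : increment_autocorrelation X n%:R / n%:R `^ (2 * H - 2) @[n --> \oo] --> L.
  exact: (cvg_comp _ _ (@cvgr_idn R) cL).
under eq_cvg do rewrite /Gam mulrAC.
by apply: cvgM cn _; exact: cvg_cst.
Qed.

Let v_diff2 n : (v n.+2 - v n.+1) - (v n.+1 - v n) = 2 * Gam n.+1.
Proof. exact: (kernel_diff2 B_sym B0 B_stat). Qed.

Let near_dyadic (Q : set R) : (\forall tau \near +oo, Q tau) ->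
  exists j0 : nat, forall j, (j0 <= j)%N -> Q (2 ^ j)%:R.
Proof.
move=> QF; have [n0 _ hn] := @cvgr_idn R _ QF.
exists n0 => j n0j; apply: hn => /=; apply: (leq_trans n0j).
by rewrite ltnW// ltn_expl.
Qed.

Let ln2_gt0 : 0 < ln 2 :> R. Proof. by rewrite ln_gt0// ltr1n. Qed.

Let hurst_pow2 j : hurst_exponent_delay X (2 ^ j)%:R =
  (ln (v (2 ^ j.+1)%N / v (2 ^ j)%N) / ln 2 / 2)%:E.
Proof. by rewrite hurst_exponent_delay_nat ?expn_gt0// double_pow2. Qed.

Let powR2_le b c : (2 `^ (2 * b) <= 2 `^ (2 * c) :> R) = (b <= c).
Proof.
have p a : 0 < 2 `^ (2 * a) :> R by rewrite powR_gt0.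
by rewrite -ler_ln ?posrE// !ln_powR ler_pM2r// ler_pM2l.
Qed.

(** Real delays are restricted to the powers of two, which are enough for
    both inequalities. *)
Lemma eventually_hurst_ge (b : R) :
  (\forall tau \near +oo, (b%:E <= hurst_exponent_delay X tau)%E) -> b <= H.
Proof.
move=> /near_dyadic[j0 hb]; have [L L0 GL] := Gam_lim.
rewrite -powR2_le.
apply: (dyadic_ratio_ge_bound v_diff2 v_gt0 H_range L0 GL (j0 := j0)).
move=> j /hb; rewrite hurst_pow2 lee_fin.
have [v1 v2] : 0 < v (2 ^ j)%N /\ 0 < v (2 ^ j.+1)%N by rewrite !v_gt0 ?expn_gt0.
rewrite !ler_pdivlMr// => h.
rewrite -ler_pdivlMr// -ler_ln ?posrE ?divr_gt0 ?powR_gt0//.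
by rewrite ln_powR; apply: le_trans h; rewrite (mulrC 2).
Qed.

Lemma eventually_hurst_le (b : R) :
  (\forall tau \near +oo, (hurst_exponent_delay X tau <= b%:E)%E) -> H <= b.
Proof.
move=> /near_dyadic[j0 hb]; have [L L0 GL] := Gam_lim.
have q0 : 0 < 2 `^ (2 * b) :> R by rewrite powR_gt0.
rewrite -powR2_le.
apply: (dyadic_ratio_le_bound v_diff2 v_gt0 H_range L0 GL q0 (j0 := j0)).
move=> j /hb; rewrite hurst_pow2 lee_fin.
have [v1 v2] : 0 < v (2 ^ j)%N /\ 0 < v (2 ^ j.+1)%N by rewrite !v_gt0 ?expn_gt0.
rewrite !ler_pdivrMr// => h; rewrite -ler_pdivrMr// -ler_ln ?posrE ?divr_gt0//.
by rewrite ln_powR; apply: le_trans h _; rewrite (mulrC 2).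
Qed.

Lemma cvgr_ln_pinfty : ln x @[x --> +oo] --> (+oo : set_system R).
Proof.
apply/cvgryPge => A; near=> x.
have : expR A <= x by near: x; exact: nbhs_pinfty_ge.
move=> Ax; have x0 : 0 < x := lt_le_trans (expR_gt0 A) Ax.
by rewrite -(expRK A) ler_ln ?posrE ?expR_gt0.
Unshelve. all: by end_near. Qed.

(** The logarithm of [c tau / tau ^ (2H - 2)] has a finite limit, so it is
    negligible with respect to [ln tau]. *)
Lemma is_hurst_exponent_of_power_law : is_hurst_exponent X H.
Proof.
have [L L0 cL] := c_lim.
exists (2 * H - 2); last by lra.
set c := increment_autocorrelation X in cL *.
have lnV : (ln x)^-1 @[x --> +oo] --> (0 : R).
  apply/gtr0_cvgV0; last exact: cvgr_ln_pinfty.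
  near=> x; apply: ln_gt0; near: x; exact: nbhs_pinfty_gt.
have cN : `|c x / x `^ (2 * H - 2)| @[x --> +oo] --> `|L| by apply: cvg_norm.
have lnc : ln `|c x / x `^ (2 * H - 2)| @[x --> +oo] --> ln `|L|.
  by apply: (continuous_cvg _ _ cN); apply: continuous_ln; rewrite normr_gt0.
have main : ln `|c x / x `^ (2 * H - 2)| * (ln x)^-1 + (2 * H - 2) @[x --> +oo] -->
    (ln `|L| * 0 + (2 * H - 2)).
  by apply: cvgD; [exact: cvgM|exact: cvg_cst].
rewrite -[X in _ --> X]add0r -[X in X + _](mulr0 (ln `|L|)).
apply: cvg_trans main; apply: near_eq_cvg; near=> x.
have x1 : 1 < x by near: x; exact: nbhs_pinfty_gt.
have x0 : 0 < x by lra.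
have L2 : 0 < `|L| / 2 by rewrite divr_gt0// normr_gt0.
have : `|L| / 2 < `|c x / x `^ (2 * H - 2)|.
  near: x; apply: (cvgr_gt _ cN); rewrite ltr_pdivrMr// ltr_pMr ?normr_gt0//.
  by rewrite ltr1n.
move=> /(lt_trans L2) ; rewrite normr_gt0 => cx.
have P0 : 0 < x `^ (2 * H - 2) by rewrite powR_gt0.
have c0 : c x != 0 by apply: contra_neq cx => ->; rewrite mul0r.
rewrite normrM normfV (gtr0_norm P0) ln_div ?posrE ?normr_gt0// ln_powR.
by field; rewrite gt_eqF// ln_gt0.
Unshelve. all: by end_near. Qed.

End process.

(** * Limits *)

Lemma ereal_gt_real (R : realType) (a : R) (y : \bar R) : (a%:E < y)%E ->
  exists2 b : R, a < b & (b%:E < y)%E.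
Proof.
case: y => [r| |]//; last by move=> _; exists (a + 1); [rewrite ltrDl|rewrite ltry].
by rewrite lte_fin => ar; exists ((a + r) / 2); rewrite ?lte_fin; lra.
Qed.

Lemma ereal_lt_real (R : realType) (a : R) (y : \bar R) : (y < a%:E)%E ->
  exists2 b : R, b < a & (y < b%:E)%E.
Proof.
case: y => [r| |]//; last by move=> _; exists (a - 1); [rewrite ltrBlDr ltrDl|rewrite ltNyr].
by rewrite lte_fin => ar; exists ((a + r) / 2); rewrite ?lte_fin; lra.
Qed.

Theorem theorem1 (d : measure_display) (T : measurableType d) (R : realType)
    (P : probability T R) (X : R -> {RV P >-> R}) (H : R)
    (X_gaussian : gaussian_process X)
    (X_0 : {ae P, forall w, X 0 w = 0})
    (X_centered : forall t : R, 0 <= t -> ('E_P[X t] = 0)%E)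
    (X_cov : forall tau s t : R, 0 <= tau -> 0 <= s -> 0 <= t ->
      covariance P (X (s + tau + 1) \- X (s + tau)) (X (s + 1) \- X s) =
      covariance P (X (t + tau + 1) \- X (t + tau)) (X (t + 1) \- X t))
    (X_var : forall t : R, 0 < t -> (0 < 'V_P[X t] < +oo)%E)
    (H_range : 2^-1 <= H < 1)
    (c_lim : exists2 L : R, L != 0 &
      increment_autocorrelation X tau / tau `^ (2 * H - 2)
        @[tau --> +oo] --> L) :
  [/\ is_hurst_exponent X H,
      (limf_einf (hurst_exponent_delay X) (+oo%R : set_system R) <= H%:E)%E,
      (H%:E <= limf_esup (hurst_exponent_delay X) (+oo%R : set_system R))%E &
      forall l : \bar R,
        hurst_exponent_delay X tau @[tau --> +oo] --> l -> l = H%:E].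
Proof.
have H_ge := eventually_hurst_ge X_gaussian X_0 X_centered X_cov X_var H_range c_lim.
have H_le := eventually_hurst_le X_gaussian X_0 X_centered X_cov X_var H_range c_lim.
split.
- exact: is_hurst_exponent_of_power_law c_lim.
- rewrite limf_einfE; apply: ge_ereal_sup => _ [V FV <-].
  rewrite leNgt; apply/negP => /ereal_gt_real[b Hb bV].
  suff : b <= H by rewrite leNgt Hb.
  apply: H_ge; apply: filterS FV => x Vx; apply: le_trans (ltW bV) _.
  by apply: ereal_inf_lbound; exists x.
- rewrite limf_esupE; apply: le_ereal_inf_tmp => _ [V FV <-].
  rewrite leNgt; apply/negP => /ereal_lt_real[b Hb bV].
  suff : H <= b by rewrite leNgt Hb.
  apply: H_le; apply: filterS FV => x Vx; apply: le_trans (ltW bV).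
  by apply: ereal_sup_ubound; exists x.
- move=> l fl; apply/eqP; rewrite eq_le !leNgt; apply/andP; split; apply/negP.
  + move=> /ereal_gt_real[b Hb bl]; suff : b <= H by rewrite leNgt Hb.
    have near_b : \forall x \near +oo, (b%:E < hurst_exponent_delay X x)%E :=
      fl _ (open_ereal_gt' bl).
    by apply: H_ge; apply: filterS near_b => x /ltW.
  + move=> /ereal_lt_real[b Hb bl]; suff : H <= b by rewrite leNgt Hb.
    have near_b : \forall x \near +oo, (hurst_exponent_delay X x < b%:E)%E :=
      fl _ (open_ereal_lt' bl).
    by apply: H_le; apply: filterS near_b => x /ltW.
Qed.
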